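(* Let $F$ be the standard Cauchy distribution, i.e. $1-F(x)=\tfrac12-\arctan(x)/\pi$ for $x\in\mathbb{R}$. For any $w_1,\dots,w_d\ge 0$ with $\sum_{i=1}^d w_i=1$, let $T_w(x)=\sum_{i=1}^d w_i x_i$. Then the $(F,T_w)$-combination test is universally honest, i.e., whenever $(P_i)_{i=1}^d$ is a random vector with Uniform$(0,1)$ marginals such that $X=(X_i)_{i=1}^d$, $X_i:=F^{-1}(1-P_i)$, is multivariate regularly varying, $$\lim_{t\to+\infty}\frac{\Pr\{T_w(X)>t\}}{\Pr(X_1>t)}\le 1,$$ where the equality holds if and only if $\Theta\in(-\infty,0]^d\cup[0,\infty)^d$ holds with probability one with respect to the angular measure of $X$ (that is, for $\Theta$ distributed according to the angular probability measure of $X$).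
   Context: Multivariate regular variation: a random vector $X$ in $\mathbb{R}^d$ is multivariate regularly varying if there exist a positive function $b(t)\to\infty$ and a non-zero Borel measure $\mu$ on $\mathbb{R}^d\setminus\{0\}$, finite on Borel sets bounded away from $0$, such that $b(t)\Pr(X\in tA)\to\mu(A)$ as $t\to\infty$ for all Borel sets $A\subset\mathbb{R}^d\setminus\{0\}$ that are bounded away from $0$ and satisfy $\mu(\partial A)=0$. Angular measure: fix any norm $\|\cdot\|$ on $\mathbb{R}^d$. If $X$ is multivariate regularly varying, then as $t\to\infty$ the conditional law of $X/\|X\|$ given $\|X\|>t$ converges weakly to a probability measure $\sigma$ on the unit sphere $\{x:\|x\|=1\}$, called the angular probability measure of $X$; $\Theta=(\Theta_1,\dots,\Theta_d)$ denotes a random vector with law $\sigma$. Universal honesty: for a heavy-tailed distribution function $F$ and a combination function $h$, the $(F,h)$-combination test is universally (asymptotically) honest if $\limsup_{t\to+\infty}\Pr(h(X)>t)/\Pr(X_1>t)\le 1$ whenever $X=(F^{-1}(1-P_i))_{i=1}^d$, with $(P_i)_{i=1}^d$ having Uniform$(0,1)$ marginals, is multivariate regularly varying.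
   Formalization: ''Equality only if Θ lies in the two orthants a.s.'' is proved only when all w_i>0: with some w_j=0 it is false (X_i=Y for i≠j, X_j=−Y, Y standard Cauchy, gives ratio 1 but mixed signs). The limit, its bound ≤1, honesty and the ''if'' part hold for all w_i≥0. *)

(* Defs.v *)
From HB Require Import structures.
From mathcomp Require Import all_boot all_order all_algebra.
From mathcomp Require Import all_classical all_reals all_analysis.

Set Implicit Arguments.
Unset Strict Implicit.
Unset Printing Implicit Defensive.

Import Order.TTheory GRing.Theory Num.Theory.
Import numFieldNormedType.Exports.

Local Open Scope classical_set_scope.
Local Open Scope ring_scope.

(* MathComp-Analysis world, over an arbitrary [R : realType].  Vectors of R^d
   are row vectors; [`|x|] on them is the sup norm, which induces the usual
   topology. *)

Notation borelRV R d := (g_sigma_algebraType (@open 'rV[R]_d)).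

Section RegularVariation.
Context {R : realType} {d : nat}.

Definition bounded_away0 (A : set 'rV[R]_d) :=
  exists2 e : R, 0 < e & forall x, A x -> e <= `|x|.

Definition boundary (A : set 'rV[R]_d) := closure A `\` interior A.

Definition dilate (t : R) (A : set 'rV[R]_d) := [set t *: x | x in A].

(* A Borel measure on R^d \ {0} is encoded as a Borel measure on R^d that does
   not charge {0}.  For A bounded away from 0 the boundaries of A in R^d and in
   R^d \ {0} coincide. *)
Definition mreg_varying {disp} {T : measurableType disp} (P : probability T R)
    (X : T -> 'rV[R]_d) : Prop :=
  measurable_fun [set: T] (X : T -> borelRV R d) /\
  exists (b : R -> R) (mu : {measure set (borelRV R d) -> \bar R}),
    [/\ forall t, 0 < t -> 0 < b t,
        b t @[t --> +oo] --> +oo,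
        mu [set 0] = 0%E /\ mu [set: borelRV R d] <> 0%E,
        (forall A : set (borelRV R d), measurable A -> bounded_away0 A ->
           (mu A < +oo)%E)
      & (forall A : set (borelRV R d), measurable A -> bounded_away0 A ->
           mu (boundary A) = 0%E ->
           ((b t)%:E * P (X @^-1` dilate t A))%E @[t --> +oo] --> mu A)].

Definition is_norm (N : 'rV[R]_d -> R) : Prop :=
  [/\ forall x y, N (x + y) <= N x + N y,
      forall (a : R) x, N (a *: x) = `|a| * N x
    & forall x, N x = 0 -> x = 0].

Definition sphere (N : 'rV[R]_d -> R) : set 'rV[R]_d := [set x | N x = 1].

(* E[f(X/N(X)) | N(X) > t] *)
Definition cond_angle_mean {disp} {T : measurableType disp}
    (P : probability T R) (X : T -> 'rV[R]_d) (N f : 'rV[R]_d -> R) (t : R) : R :=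
  (\int[P]_(x in [set x | (t < N (X x))%R]) f ((N (X x))^-1 *: X x))
  / fine (P [set x | t < N (X x)]).

(* The law sigma on the unit sphere is encoded as a Borel law on R^d giving
   mass 1 to the sphere.  The sphere is compact, so that the test functions of
   weak convergence are all the continuous functions on it. *)
Definition angular_measure {disp} {T : measurableType disp}
    (P : probability T R) (X : T -> 'rV[R]_d) (N : 'rV[R]_d -> R)
    (sigma : probability (borelRV R d) R) : Prop :=
  sigma (sphere N) = 1%E /\
  forall f : 'rV[R]_d -> R, {within sphere N, continuous f} ->
    cond_angle_mean P X N f t @[t --> +oo] --> \int[sigma]_(x in sphere N) f x.

(* (-oo, 0]^d \cup [0, +oo)^d *)
Definition same_sign_orthants : set 'rV[R]_d :=
  [set x | forall i, x ord0 i <= 0] `|` [set x | forall i, 0 <= x ord0 i].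

End RegularVariation.

Section CombinationTests.
Context {R : realType}.

Definition quantile (F : R -> R) (u : R) : R := inf [set x | u <= F x].

Definition uniform_marginals {disp} {T : measurableType disp}
    (P : probability T R) (d : nat) (U : 'I_d -> {RV P >-> R}) : Prop :=
  forall i (A : set R), measurable A ->
    distribution P (U i) A = uniform_prob (@ltr01 R) A.

Definition scores (F : R -> R) {disp} {T : measurableType disp}
    (P : probability T R) (d : nat) (U : 'I_d -> {RV P >-> R})
    (x : T) : 'rV[R]_d := \row_i quantile F (1 - U i x).

(* Pr(h(X) > t) / Pr(X_1 > t); the dimension is n.+1 so that X_1 exists. *)
Definition tail_ratio {disp} {T : measurableType disp} (P : probability T R)
    (n : nat) (h : 'rV[R]_n.+1 -> R) (X : T -> 'rV[R]_n.+1) (t : R) : R :=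
  fine (P [set x | t < h (X x)]) / fine (P [set x | t < X x ord0 ord0]).

Definition universally_honest (F : R -> R) (n : nat)
    (h : 'rV[R]_n.+1 -> R) : Prop :=
  forall (disp : measure_display) (T : measurableType disp)
    (P : probability T R) (U : 'I_n.+1 -> {RV P >-> R}),
    uniform_marginals U -> mreg_varying P (scores F U) ->
    (limf_esup (fun t => (tail_ratio P h (scores F U) t)%:E) (+oo%R : set_system R)
       <= 1)%E.

Definition cauchy_cdf (x : R) : R := 1 - (2^-1 - atan x / pi).

Definition weighted_sum (n : nat) (w : 'I_n -> R) (x : 'rV[R]_n) : R :=
  \sum_i w i * x ord0 i.

End CombinationTests.

(* Main.v *)
(* Since P(X_i > t) ~ 1/(pi t), the tail ratio behaves like pi t P(T_w(X) > t);
   regular variation is needed only for the existence of its limit L.  Instead of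
   decomposing mu in polar coordinates, sum over the integer levels
   k = 1, ..., m: the number of k <= m with k < y is min(y^+, m) up to 1, which
   is linear in y^+ as long as y <= m.  With
     f(x) = sum_i w_i x_i^+ - (w.x)^+ >= 0
   this shows that
     sum_(k <= m) (P(X_1 > k) - P(T_w(X) > k) - E[f(X/N(X)); N(X) > k])
   stays bounded, the error on {N(X) > c m} being at most
   O(m P(N(X) > c m)) = O(1).  As the harmonic series diverges, the summands
   cannot be of exact order 1/k with a constant sign, whence L <= 1, with L = 1
   if and only if the integral of f against the angular measure vanishes, i.e.
   f = 0 almost surely; for positive weights f vanishes exactly on the two
   orthants. *)
From HB Require Import structures.
Require Import Defs.
From mathcomp Require Import all_boot all_order all_algebra.
From mathcomp Require Import all_classical all_reals all_analysis.
From mathcomp Require Import measurable_realfun.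
From mathcomp Require Import ring lra.
Set Implicit Arguments.
Unset Strict Implicit.
Unset Printing Implicit Defensive.
Import Order.TTheory GRing.Theory Num.Theory.
Import numFieldNormedType.Exports.
Local Open Scope classical_set_scope.
Local Open Scope ring_scope.

(** * Integer levels and the harmonic series *)

(** From some rank on the terms lie below [- dl] times the harmonic ones, so the partial sums tend
    to minus infinity and cannot stay above [- C]. Each comparison of tails below ends in this
    contradiction. *)
Lemma sum_le_harmonicN_unbounded (R : realType) (a : R^nat) (dl C : R) :
  0 < dl -> (\forall k \near \oo, a k <= - (dl / k.+1%:R)) ->
  (forall m, - C <= \sum_(k < m) a k) -> False.
Proof.
move=> dl0 [k0 _ ak] aC.
have Hoo : series (@harmonic R) m @[m --> \oo] --> +oo.
  apply: nondecreasing_dvgn_lt; last exact: dvg_harmonic.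
  by apply: nondecreasing_series => k _ _; exact: harmonic_ge0.
have decomp m : (k0 <= m)%N ->
    \sum_(k < m) a k <= \sum_(k < k0) a k
      - dl * (series (@harmonic R) m - series (@harmonic R) k0).
  move=> /subnK <-; elim: (m - k0)%N => [|j IH].
    by rewrite add0n subrr mulr0 subr0.
  rewrite addSn big_ord_recr/= seriesSr.
  have := ak (j + k0)%N (leq_addl _ _); rewrite /harmonic/=.
  move: IH; set v := _.+1%:R^-1; set s := series _ _ => /= IH av.
  rewrite /harmonic/= -/v. lra.
(* The rank [m] is taken so large that the terms from [k0] on outweigh the first [k0] ones and push
   the partial sum down to [- C - 1]. *)
have [m [k0m Hm]] : exists m, (k0 <= m)%N /\
    (C + \sum_(k < k0) a k + 1) / dl + series (@harmonic R) k0
      <= series (@harmonic R) m.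
  move/cvgryPge : Hoo => /(_ ((C + \sum_(k < k0) a k + 1) / dl
    + series (@harmonic R) k0)) [m1 _ Hm1].
  exists (maxn k0 m1); split; first exact: leq_maxl.
  by apply: Hm1; rewrite /= leq_maxr.
have := aC m; have := decomp _ k0m.
have : C + \sum_(k < k0) a k + 1 <=
    dl * (series (@harmonic R) m - series (@harmonic R) k0).
  by rewrite mulrC -ler_pdivrMr// lerBrDr.
lra.
Qed.

Section level_count.
Context {R : realType}.
Implicit Types y : R.

(* Equal to [min(y^+, m)] up to an error at most 1. *)
Definition level_count (m : nat) y : R := \sum_(k < m) (k.+1%:R < y)%R%:R.

Lemma level_count_ge0 m y : 0 <= level_count m y.
Proof. by apply: sumr_ge0 => k _; exact: ler0n. Qed.

Lemma level_count_le m y : level_count m y <= m%:R.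
Proof.
rewrite -[in leRHS](card_ord m) -sum1_card natr_sum.
by apply: ler_sum => k _; rewrite ler_nat leq_b1.
Qed.

Lemma level_count_gt m y : m%:R < y -> level_count m y = m%:R.
Proof.
move=> my; rewrite /level_count -[in RHS](card_ord m) -sum1_card natr_sum.
apply: eq_bigr => k _.
suff -> : k.+1%:R < y by [].
by apply: le_lt_trans my; rewrite ler_nat ltn_ord.
Qed.

(** For [0 < y <= m] the count runs over all positive integers strictly below [y], so it is the
    ceiling of [y] minus 1; for [y <= 0] it is 0. *)
Lemma level_count_itv m y : y <= m%:R ->
  Num.max y 0 - 1 <= level_count m y <= Num.max y 0.
Proof.
elim: m => [|m IH] ym.
  by rewrite /level_count big_ord0 max_r// lexx lerBlDr add0r ler01.
have -> : level_count m.+1 y = level_count m y.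
  by rewrite /level_count big_ord_recr/= ltNge ym addr0.
have [ymm|my] := leP y m%:R; first exact: IH.
rewrite level_count_gt//.
have y0 : 0 <= y by apply: le_trans (ltW my).
by rewrite max_l// (ltW my) andbT lerBlDr natr1.
Qed.

(** Replacing each count by a positive part turns the left-hand side into the identity assumed for
    [h * N], hence into 0. This costs a bounded error as long as no count is truncated at [m]. In
    the application [h] is the defect at the angle [x / N]. *)
Lemma level_count_sum_approx (n : nat) (w : 'I_n -> R) (x : 'I_n -> R)
    (N h K : R) (m : nat) :
  (forall i, 0 <= w i) -> \sum_i w i = 1 -> 1 <= K -> 0 <= N ->
  (forall i, `|x i| <= K * N) -> 0 <= h <= K ->
  h * N = \sum_i w i * Num.max (x i) 0 - Num.max (\sum_i w i * x i) 0 ->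
  `| \sum_i w i * level_count m (x i) - level_count m (\sum_i w i * x i)
     - h * level_count m N | <= (1 + K) * (1 + m%:R * (m%:R < K * N)%R%:R).
Proof.
move=> w0 w1 K1 N0 xKN /andP[h0 hK] hN.
have wle (y z : 'I_n -> R) :
    (forall i, y i <= z i) -> \sum_i w i * y i <= \sum_i w i * z i.
  by move=> yz; apply: ler_sum => i _; exact: ler_wpM2l.
have wcst (c : R) : \sum_i w i * c = c by rewrite -mulr_suml w1 mul1r.
(* If [K * N <= m], then [N], all [x i] and their weighted mean are at most [m]; the three errors
   add up to at most [1 + h]. *)
have [KNm|mKN] := leP (K * N) m%:R.
  have Nm : N <= m%:R by rewrite (le_trans _ KNm)// ler_peMl.
  have xm i : x i <= m%:R by rewrite (le_trans (ler_norm _))// (le_trans (xKN i)).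
  have wxm : \sum_i w i * x i <= m%:R.
    by rewrite -[leRHS]wcst; exact: wle.
  have Sx1 : \sum_i w i * Num.max (x i) 0 - 1 <= \sum_i w i * level_count m (x i).
    rewrite -[in leLHS](wcst 1) -sumrB.
    under eq_bigr do rewrite -mulrBr.
    by apply: wle => i; have /andP[] := level_count_itv (xm i).
  have Sx2 : \sum_i w i * level_count m (x i) <= \sum_i w i * Num.max (x i) 0.
    by apply: wle => i; have /andP[] := level_count_itv (xm i).
  have /andP[Sw1 Sw2] := level_count_itv wxm.
  have /andP[SN1 SN2] := level_count_itv Nm.
  have SN1' : h * N - h <= h * level_count m N.
    by rewrite -{2}[h]mulr1 -mulrBr ler_wpM2l// (le_trans _ SN1)// lerB// le_max lexx.
  have SN2' : h * level_count m N <= h * N.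
    by rewrite ler_wpM2l// (le_trans SN2)// max_l.
  rewrite mulr0 addr0 mulr1 ler_norml; apply/andP; split; lra.
(* With truncation, every count lies between 0 and [m], which already gives the bound
   [(1 + K) * m]. *)
have SN0 := level_count_ge0 m N.
have SNm := level_count_le m N.
have Sw0 := level_count_ge0 m (\sum_i w i * x i).
have Swm := level_count_le m (\sum_i w i * x i).
have Sx0 : 0 <= \sum_i w i * level_count m (x i).
  by rewrite -[leLHS]wcst; apply: wle => i; exact: level_count_ge0.
have Sxm : \sum_i w i * level_count m (x i) <= m%:R.
  by rewrite -[leRHS]wcst; apply: wle => i; exact: level_count_le.
have hS0 : 0 <= h * level_count m N by rewrite mulr_ge0.
have hSm : h * level_count m N <= K * m%:R by rewrite ler_pM.
have m0 : 0 <= m%:R :> R by [].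
have : 0 <= K * m%:R by rewrite mulr_ge0//; lra.
rewrite mulr1 ler_norml => Km; apply/andP; split; lra.
Qed.

End level_count.

(** * Summed tail probabilities *)

Section expectation.
Context {disp} {T : measurableType disp} {R : realType} (P : probability T R).

Lemma integrable_bounded (D : set T) (f : T -> R) (M : R) :
  measurable D -> measurable_fun D f -> (forall x, `|f x| <= M) ->
  P.-integrable D (EFin \o f).
Proof.
move=> mD mf fM; apply: measurable_bounded_integrable => //.
  exact: le_lt_trans (probability_le1 P mD) (ltry _).
exists M; split; first exact: num_real.
by move=> r Mr x _; apply: (le_trans (fM x)); exact: ltW.
Qed.

(** Here and in the next three lemmas the real operation is placed inside [EFin], the form in which
    rules for the real-valued integral ask for integrability. *)
Lemma integrable_EFinD (D : set T) (f g : T -> R) : measurable D ->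
  P.-integrable D (EFin \o f) -> P.-integrable D (EFin \o g) ->
  P.-integrable D (EFin \o (fun x => f x + g x)).
Proof. by move=> mD fi gi; have := integrableD mD fi gi. Qed.

Lemma integrable_EFinB (D : set T) (f g : T -> R) : measurable D ->
  P.-integrable D (EFin \o f) -> P.-integrable D (EFin \o g) ->
  P.-integrable D (EFin \o (fun x => f x - g x)).
Proof. by move=> mD fi gi; have := integrableB mD fi gi. Qed.

Lemma integrable_EFinZl (D : set T) (c : R) (f : T -> R) : measurable D ->
  P.-integrable D (EFin \o f) -> P.-integrable D (EFin \o (fun x => c * f x)).
Proof. by move=> mD fi; have := integrableZl mD c fi. Qed.

Lemma integrable_EFin_sum (I : Type) (r : seq I) (D : set T) (f : I -> T -> R) :
  measurable D -> (forall i, P.-integrable D (EFin \o f i)) ->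
  P.-integrable D (EFin \o (fun x => \sum_(i <- r) f i x)).
Proof.
move=> mD fi; rewrite (_ : _ \o _ = fun x => (\sum_(i <- r) (f i x)%:E)%E).
  by apply: integrable_sum => // i _; exact: fi.
by apply/funext => x /=; rewrite sumEFin.
Qed.

Lemma Rintegral_sum (I : Type) (r : seq I) (D : set T) (f : I -> T -> R) :
  measurable D -> (forall i, P.-integrable D (EFin \o f i)) ->
  \int[P]_(x in D) (\sum_(i <- r) f i x) = \sum_(i <- r) \int[P]_(x in D) f i x.
Proof.
move=> mD fi.
elim: r => [|i s IH].
  under eq_Rintegral do rewrite big_nil.
  by rewrite big_nil Rintegral_cst// mul0r.
under eq_Rintegral do rewrite big_cons.
by rewrite RintegralD ?IH ?big_cons//; exact: integrable_EFin_sum.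
Qed.

Lemma mem_superlevel (Y : T -> R) (a : R) x :
  (x \in [set x | a < Y x]) = (a < Y x).
Proof. by apply/idP/idP; rewrite inE. Qed.

Lemma measurable_superlevel (Y : T -> R) (a : R) :
  measurable_fun setT Y -> measurable [set x | a < Y x].
Proof.
move=> mY; rewrite -[X in measurable X]setTI.
rewrite (_ : [set x | a < Y x] = Y @^-1` `]a, +oo[); first exact: mY.
by apply/seteqP; split => x /=; rewrite in_itv/= andbT.
Qed.

Lemma measurable_level_count m (Y : T -> R) :
  measurable_fun setT Y -> measurable_fun setT (level_count m \o Y).
Proof.
move=> mY; rewrite /level_count.
rewrite (_ : _ \o _ = (fun x => \sum_(k < m) \1_[set x | k.+1%:R < Y x] x)).
  apply: measurable_sum => k; apply: measurable_indic.
  exact: measurable_superlevel.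
apply/funext => x /=; apply: eq_bigr => k _.
by rewrite indicE mem_superlevel.
Qed.

(** A discrete layer-cake formula, by exchanging a finite sum with the integral. The count is
    bounded, so a heavy-tailed [Y] without a mean is allowed. *)
Lemma Rintegral_mul_level_count m (h Y : T -> R) (M : R) :
  measurable_fun setT h -> (forall x, `|h x| <= M) -> measurable_fun setT Y ->
  \int[P]_x (h x * level_count m (Y x)) =
  \sum_(k < m) \int[P]_(x in [set x | k.+1%:R < Y x]) h x.
Proof.
move=> mh hM mY.
have mYk k := measurable_superlevel k mY.
under eq_Rintegral do rewrite /level_count mulr_sumr.
rewrite Rintegral_sum//.
  apply: eq_bigr => k _; rewrite [RHS]Rintegral_mkcond.
  apply: eq_Rintegral => x _; rewrite patchE mem_superlevel.
  by case: ifPn => _; rewrite ?mulr1 ?mulr0.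
move=> k; apply: (@integrable_bounded _ _ M) => //.
  apply: measurable_funM => //.
  have := @measurable_indic _ _ R setT _ (mYk k.+1%:R).
  apply: eq_measurable_fun => x _.
  by rewrite indicE mem_superlevel.
move=> x; rewrite normrM (le_trans _ (hM x))// ler_piMr//.
by case: (_ < _); rewrite ?normr0 ?normr1.
Qed.

Lemma Rintegral_level_count m (Y : T -> R) : measurable_fun setT Y ->
  \int[P]_x level_count m (Y x) =
  \sum_(k < m) fine (P [set x | k.+1%:R < Y x]).
Proof.
move=> mY; transitivity (\int[P]_x (cst 1 x * level_count m (Y x))).
  by apply: eq_Rintegral => x _; rewrite mul1r.
rewrite (@Rintegral_mul_level_count _ _ _ 1)//; last by move=> x; rewrite normr1.
apply: eq_bigr => k _; rewrite Rintegral_cst ?mul1r//.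
exact: measurable_superlevel.
Qed.

(** Integrating the pointwise estimate [level_count_sum_approx] turns counts into sums of tail
    probabilities. The bound stays uniform in [m] when the tail of [N] is of order [1 / t]. *)
Lemma sum_tail_approx (n : nat) (w : 'I_n -> R) (Y : 'I_n -> T -> R)
    (N h : T -> R) (K : R) (m : nat) :
  (forall i, 0 <= w i) -> \sum_i w i = 1 -> 1 <= K ->
  (forall i, measurable_fun setT (Y i)) -> measurable_fun setT N ->
  measurable_fun setT h ->
  (forall x, 0 <= N x) -> (forall x i, `|Y i x| <= K * N x) ->
  (forall x, 0 <= h x <= K) ->
  (forall x, h x * N x = \sum_i w i * Num.max (Y i x) 0
                         - Num.max (\sum_i w i * Y i x) 0) ->
  `| \sum_(k < m) (\sum_i w i * fine (P [set x | k.+1%:R < Y i x])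
       - fine (P [set x | k.+1%:R < \sum_i w i * Y i x])
       - \int[P]_(x in [set x | k.+1%:R < N x]) h x) |
  <= (1 + K) * (1 + m%:R * fine (P [set x | m%:R < K * N x])).
Proof.
move=> w0 w1 K1 mY mN mh N0 YN hK hN.
have K0 : 0 <= K by lra.
have mV : measurable_fun setT (fun x => \sum_i w i * Y i x).
  by apply: measurable_sum => i; exact: measurable_funM.
have mKN : measurable_fun setT (fun x => K * N x) by exact: measurable_funM.
have ilc (Z : T -> R) : measurable_fun setT Z ->
    P.-integrable setT (EFin \o (level_count m \o Z)).
  move=> mZ; apply: (@integrable_bounded _ _ m%:R) => //.
    exact: measurable_level_count.
  by move=> x; rewrite ger0_norm ?level_count_ge0 ?level_count_le.
have hnorm x : `|h x| <= K by case/andP: (hK x) => h0 hK'; rewrite ger0_norm.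
have ihlc : P.-integrable setT (EFin \o (fun x => h x * level_count m (N x))).
  apply: (@integrable_bounded _ _ (K * m%:R)) => //.
    by apply: measurable_funM => //; exact: measurable_level_count.
  move=> x; rewrite normrM ler_pM//.
  by rewrite ger0_norm ?level_count_ge0 ?level_count_le.
have iwlc i : P.-integrable setT (EFin \o (fun x => w i * level_count m (Y i x))).
  by apply: integrable_EFinZl => //; exact: ilc.
have iswlc := integrable_EFin_sum (index_enum 'I_n) measurableT iwlc.
(* [Z] is the pointwise error, whose integral is the sum to be bounded; [B] below dominates its
   absolute value. *)
pose Z x := \sum_i w i * level_count m (Y i x)
  - level_count m (\sum_i w i * Y i x) - h x * level_count m (N x).
have iB : P.-integrable setT (EFin \o (fun x => \sum_i w i * level_count m (Y i x)
  - level_count m (\sum_i w i * Y i x))).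
  by apply: integrable_EFinB => //; exact: ilc.
have iZ : P.-integrable setT (EFin \o Z) by exact: integrable_EFinB.
have -> : \sum_(k < m) (\sum_i w i * fine (P [set x | k.+1%:R < Y i x])
       - fine (P [set x | k.+1%:R < \sum_i w i * Y i x])
       - \int[P]_(x in [set x | k.+1%:R < N x]) h x) = \int[P]_x Z x.
  rewrite /Z RintegralB// RintegralB//; last exact: (ilc (fun x => \sum_i w i * Y i x)).
  rewrite (Rintegral_level_count m mV) (Rintegral_mul_level_count m mh hnorm mN).
  rewrite Rintegral_sum// !sumrB; congr (_ - _ - _).
  rewrite exchange_big/=; apply: eq_bigr => i _.
  by rewrite RintegralZl ?Rintegral_level_count ?mulr_sumr//; exact: ilc.
have mA : measurable [set x | m%:R < K * N x] by exact: measurable_superlevel.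
apply: le_trans (le_normr_Rintegral _ iZ) _ => //.
pose B x := (1 + K) * (1 + m%:R * \1_[set x | m%:R < K * N x] x).
have iI : P.-integrable setT (EFin \o (\1_[set x | m%:R < K * N x] : T -> R)).
  apply: (@integrable_bounded _ _ 1) => // x.
  by rewrite indicE; case: (_ \in _); rewrite ?normr0 ?normr1.
have i1 : P.-integrable setT (EFin \o (cst 1 : T -> R)).
  by apply: (@integrable_bounded _ _ 1) => // x; rewrite normr1.
have imI := integrable_EFinZl m%:R measurableT iI.
have i1mI := integrable_EFinD measurableT i1 imI.
have iBB : P.-integrable setT (EFin \o B) by exact: integrable_EFinZl.
have -> : (1 + K) * (1 + m%:R * fine (P [set x | m%:R < K * N x])) = \int[P]_x B x.
  rewrite /B RintegralZl// RintegralD// RintegralZl// Rintegral_cst//.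
  congr (_ * (_ + _ * _)).
    by rewrite mul1r; exact: (esym (congr1 fine (probability_setT P))).
  by rewrite /Rintegral integral_indic// setIT.
apply: le_Rintegral => //; first exact: integrable_norm iZ.
move=> x _; rewrite /Z /B indicE mem_superlevel.
exact: level_count_sum_approx.
Qed.

End expectation.

(** * Cauchy tails *)

Lemma cvg_pinftyMr {R : realType} (V : Type) (f : R -> V) (F : set_system V) (s : R) :
  0 < s -> f t @[t --> +oo] `=>` F -> f (t * s) @[t --> +oo] `=>` F.
Proof.
move=> s0; apply: cvg_comp.
apply/cvgryPge => A; near=> t; rewrite -(ler_pdivrMr _ _ s0).
by near: t; apply: nbhs_pinfty_ge; exact: num_real.
Unshelve. all: by end_near. Qed.

Section cauchy_tail.
Context {R : realType}.
Implicit Types (t u x : R).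

Definition cauchy_tail t : R := 2^-1 - atan t / pi.

Lemma cauchy_tail_itv t : 0 < cauchy_tail t < 1.
Proof.
have p0 := pi_gt0 R.
rewrite /cauchy_tail subr_gt0 ltr_pdivrMr// mulrC atan_ltpi2/=.
rewrite ltrBlDr -ltrBlDl ltr_pdivlMr//.
by apply: le_lt_trans (atan_gtNpi2 t); lra.
Qed.

(** The tangent of [pi / 2 - a] is the inverse of that of [a], and [pi / 2 - atan t] lies in the
    interval on which [atan] inverts [tan]. *)
Lemma atanV t : 0 < t -> atan t^-1 = pi / 2 - atan t.
Proof.
move=> t0; have p0 := pi_gt0 R.
have a0 : 0 < atan t by rewrite -(atan0 R) lt_atan.
have a1 := atan_ltpi2 t.
have sa0 : sin (atan t) != 0 by rewrite gt_eqF// sin_gt0_pihalf// a0.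
have ca0 : cos (atan t) != 0 by rewrite gt_eqF// cos_gt0_pihalf// a1 andbT; lra.
rewrite -[in LHS](atanK t) -[RHS]tanK;
  last by rewrite in_itv/=; apply/andP; split; lra.
congr atan; rewrite /tan -[pi / 2 - _]opprB sinN cosN.
rewrite cosBpihalf sinBpihalf opprK.
by rewrite invf_div.
Qed.

(** The middle term is [t * atan t^-1], and the mean value theorem on [[0, t^-1]] makes it
    [(1 + c ^+ 2)^-1] for some [c] between 0 and [t^-1]. *)
Lemma cauchy_tail_bounds t : 0 < t ->
  1 - t^-1 ^+ 2 <= pi * t * cauchy_tail t <= 1.
Proof.
move=> t0; have p0 := pi_gt0 R.
have -> : pi * t * cauchy_tail t = t * atan t^-1.
  have aux (p a : R) : p != 0 -> p * t * (2^-1 - a / p) = t * (p / 2 - a).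
    by move=> pN0; field.
  by rewrite atanV// /cauchy_tail aux// gt_eqF.
have v0 : 0 < t^-1 by rewrite invr_gt0.
have datan z : z \in `]0, t^-1[ -> is_derive z 1 atan (1 + z ^+ 2)^-1.
  by move=> _; exact: is_derive1_atan.
have catan : {within `[0, t^-1], continuous (@atan R)}.
  by apply: derivable_within_continuous => z _; exact: ex_derive.
have [c] := MVT v0 datan catan.
rewrite in_itv/= atan0 !subr0 => /andP[c0 ct] ->.
rewrite mulrCA mulfV ?gt_eqF// mulr1.
have c2 : c ^+ 2 <= t^-1 ^+ 2 by rewrite lerXn2r ?nnegrE// ltW.
have c20 : 0 <= c ^+ 2 by exact: sqr_ge0.
rewrite [X in _ && X]invf_le1; last by lra.
rewrite [X in _ && X]lerDl c20 andbT -[leRHS]mul1r ler_pdivlMr; last by lra.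
nra.
Qed.

Lemma cvg_cauchy_tail : pi * t * cauchy_tail t @[t --> +oo] --> (1 : R).
Proof.
apply/cvgrPdist_le => e e0; near=> t.
have t1 : 1 <= t by near: t; apply: nbhs_pinfty_ge; exact: num_real.
have te : e^-1 <= t by near: t; apply: nbhs_pinfty_ge; exact: num_real.
have t0 : 0 < t by lra.
have /andP[lo up] := cauchy_tail_bounds t0.
rewrite ger0_norm ?subr_ge0// lerBlDr -lerBlDl (le_trans _ lo)// lerD2l lerN2.
have tve : t^-1 <= e by rewrite -[e]invrK lef_pV2 ?posrE ?invr_gt0.
apply: le_trans tve; rewrite expr2 -[leRHS]mulr1.
by apply: ler_wpM2l; [rewrite invr_ge0 ltW|rewrite invf_le1].
Unshelve. all: by end_near. Qed.

Lemma cvg_cauchy_tailMr (s : R) : 0 < s ->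
  t * cauchy_tail (t * s) @[t --> +oo] --> (pi * s)^-1.
Proof.
move=> s0; have p0 := pi_gt0 R.
have h := cvg_pinftyMr s0 cvg_cauchy_tail.
rewrite -[X in _ --> X]mul1r.
have : (pi * (t * s) * cauchy_tail (t * s)) * (pi * s)^-1 @[t --> +oo] -->
    1 * (pi * s)^-1 by apply: cvgM => //; exact: cvg_cst.
apply: cvg_trans; apply: near_eq_cvg; near=> t.
have aux (p c : R) : p != 0 -> p * (t * s) * c / (p * s) = t * c.
  by move=> p0'; field; rewrite p0' gt_eqF.
by rewrite aux// gt_eqF.
Unshelve. all: by end_near. Qed.

Lemma cvg_mul_cauchy_tail : t * cauchy_tail t @[t --> +oo] --> (pi^-1 : R).
Proof.
have := cvg_cauchy_tailMr ltr01; rewrite mulr1.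
by under eq_fun do rewrite mulr1.
Qed.

(** For such [u] the angle [pi * (u - 2^-1)] lies in the interval on which [atan] inverts [tan]. The
    set whose infimum defines the quantile is thus a closed half-line, and the infimum is
    attained. *)
Lemma cauchy_cdf_tan u : 0 < u < 1 ->
  [set x | u <= cauchy_cdf x] = `[tan (pi * (u - 2^-1)), +oo[%classic.
Proof.
move=> /andP[u0 u1]; have p0 := pi_gt0 R.
have aq : atan (tan (pi * (u - 2^-1))) = pi * (u - 2^-1).
  by rewrite tanK// in_itv/=; apply/andP; split; nra.
apply/seteqP; split => x /=; rewrite in_itv/= andbT /cauchy_cdf => ux.
  rewrite leNgt; apply/negP => /lt_atan; rewrite aq -ltr_pdivrMl// mulrC; lra.
by move: ux => /le_atan; rewrite aq -ler_pdivlMl// mulrC; lra.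
Qed.

Lemma quantile_cauchy u : 0 < u < 1 ->
  quantile cauchy_cdf u = tan (pi * (u - 2^-1)).
Proof. by move=> u01; rewrite /quantile cauchy_cdf_tan// inf_itv. Qed.

Lemma quantile_cauchy_le u x : 0 < u < 1 ->
  (quantile cauchy_cdf u <= x) = (u <= cauchy_cdf x).
Proof.
move=> u01; rewrite quantile_cauchy//.
have /seteqP[h1 h2] := cauchy_cdf_tan u01.
apply/idP/idP => h; first by apply: h2; rewrite /= in_itv/= h.
by have := h1 _ h; rewrite /= in_itv/= andbT.
Qed.

(** The strict form, needed for the left tail, uses that the Cauchy distribution function is
    continuous and strictly increasing. *)
Lemma quantile_cauchy_lt u x : 0 < u < 1 ->
  (quantile cauchy_cdf u < x) = (u < cauchy_cdf x).
Proof.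
move=> /andP[u0 u1]; have p0 := pi_gt0 R.
have aq : atan (tan (pi * (u - 2^-1))) = pi * (u - 2^-1).
  by rewrite tanK// in_itv/=; apply/andP; split; nra.
rewrite quantile_cauchy ?u0// /cauchy_cdf; apply/idP/idP => [/lt_atan|].
  by rewrite aq -ltr_pdivlMl// mulrC; lra.
apply: contraTT; rewrite -!leNgt => /le_atan.
by rewrite aq -ler_pdivrMl// mulrC; lra.
Qed.

Lemma uniform_prob_itvoo (a b : R) : 0 <= a -> a <= b -> b <= 1 ->
  uniform_prob (@ltr01 R) `]a, b[ = (b - a)%:E.
Proof.
move=> a0 ab b1; rewrite /uniform_prob.
rewrite (eq_integral (cst 1%E)); last first.
  move=> x; rewrite inE/= in_itv/= => /andP[ax xb]; rewrite /uniform_pdf.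
  rewrite (_ : 0 <= x <= 1)%R ?subr0 ?invr1//.
  by apply/andP; split; lra.
rewrite integral_cst//= mul1e lebesgue_measure_itv/= lte_fin.
case: ifPn => [_|]; first by rewrite EFinB.
by rewrite -leNgt => ba; rewrite (_ : b = a) ?subrr//; apply/eqP;
  rewrite eq_le ba ab.
Qed.

End cauchy_tail.

(** * Tails of the Cauchy scores *)

Section score_tails.
Context {R : realType} {disp} {T : measurableType disp} (P : probability T R).

Lemma probability_eq_on (A B G : set T) : measurable A -> measurable B ->
  measurable G -> P G = 1%E -> A `&` G = B `&` G -> P A = P B.
Proof.
move=> mA mB mG PG AB.
have null : P (~` G) = 0%E by rewrite probability_setC// PG subee.
have onG S : measurable S -> P S = P (S `&` G).
  move=> mS; rewrite [LHS](measureDI _ mS mG) (subset_measure0 _ _ _ null) ?add0e//.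
    exact: measurableD.
  exact: measurableC.
by rewrite (onG _ mA) AB -(onG _ mB).
Qed.

Context {n : nat} {U : 'I_n -> {RV P >-> R}}.
Hypothesis U_unif : uniform_marginals U.
Hypothesis mX : forall i, measurable_fun setT (fun x => scores cauchy_cdf U x ord0 i).

Lemma uniform_marginal_itv i (a b : R) : 0 <= a -> a <= b -> b <= 1 ->
  P (U i @^-1` `]a, b[) = (b - a)%:E.
Proof. by move=> *; rewrite -uniform_prob_itvoo// -(U_unif i). Qed.

Lemma scores_tail_right i (t : R) :
  P [set x | t < scores cauchy_cdf U x ord0 i] = (cauchy_tail t)%:E.
Proof.
have /andP[c0 c1] := cauchy_tail_itv t.
rewrite -[X in _ = X%:E]subr0 -(uniform_marginal_itv i)//; try exact: ltW.
(* Off this almost sure event the infimum in [quantile] is that of an empty or unbounded set and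
   takes a default value; on it, a score above [t] means that [U i] is below [cauchy_tail t]. *)
apply: (@probability_eq_on _ _ (U i @^-1` `]0, 1[)) => //.
- rewrite -[X in measurable X]setTI.
  rewrite (_ : [set _ | _] = (fun x => scores cauchy_cdf U x ord0 i) @^-1` `]t, +oo[).
    exact: mX.
  by apply/seteqP; split => x /=; rewrite in_itv/= andbT.
- by rewrite -[X in measurable X]setTI; exact: measurable_funP.
- by rewrite -[X in measurable X]setTI; exact: measurable_funP.
- by rewrite uniform_marginal_itv// subr0.
apply/seteqP; split => x [] /=; rewrite !in_itv/= mxE => + /andP[U0 U1];
    rewrite U0 U1 => h; split => //; move: h.
  rewrite ltNge quantile_cauchy_le -?ltNge /cauchy_cdf
    -/(cauchy_tail t); first by lra.
  by apply/andP; split; lra.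
move=> /= Uc; rewrite ltNge quantile_cauchy_le -?ltNge /cauchy_cdf
    -/(cauchy_tail t); first by lra.
by apply/andP; split; lra.
Qed.

Lemma scores_tail_left i (t : R) :
  P [set x | scores cauchy_cdf U x ord0 i < - t] = (cauchy_tail t)%:E.
Proof.
have /andP[c0 c1] := cauchy_tail_itv t.
(* By symmetry of the Cauchy law, a score below [- t] means that [U i] lies in []1 - cauchy_tail t,
   1[]. *)
have -> : (cauchy_tail t)%:E = (1 - (1 - cauchy_tail t))%R%:E by congr EFin; lra.
have d0 : 0 <= 1 - cauchy_tail t by lra.
have d1 : 1 - cauchy_tail t <= 1 by lra.
rewrite -(uniform_marginal_itv i d0 d1)//.
have cdfN : cauchy_cdf (- t) = cauchy_tail t.
  by rewrite /cauchy_cdf /cauchy_tail atanN; lra.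
apply: (@probability_eq_on _ _ (U i @^-1` `]0, 1[)) => //.
- rewrite -[X in measurable X]setTI.
  rewrite (_ : [set _ | _] = (fun x => scores cauchy_cdf U x ord0 i) @^-1` `]-oo, - t[).
    exact: mX.
  by apply/seteqP; split => x /=; rewrite in_itv.
- by rewrite -[X in measurable X]setTI; exact: measurable_funP.
- by rewrite -[X in measurable X]setTI; exact: measurable_funP.
- by rewrite uniform_marginal_itv// subr0.
apply/seteqP; split => x [] /=; rewrite !in_itv/= mxE => + /andP[U0 U1];
    rewrite U0 U1 => h; split => //; move: h.
  rewrite quantile_cauchy_lt ?cdfN; first by lra.
  by apply/andP; split; lra.
rewrite ?andbT => Uc; rewrite quantile_cauchy_lt ?cdfN; first by lra.
by apply/andP; split; lra.
Qed.

End score_tails.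

(** * Regular variation *)

Section borel_rV.
Context {R : realType} {d : nat}.
Implicit Types (g : 'rV[R]_d -> R) (A : set 'rV[R]_d).

Lemma open_measurable_rV A : open A -> measurable (A : set (borelRV R d)).
Proof. by move=> oA; exact: sub_sigma_algebra. Qed.

Lemma closed_measurable_rV A : closed A -> measurable (A : set (borelRV R d)).
Proof.
move=> cA; rewrite -[A]setCK; apply: measurableC.
by apply: open_measurable_rV; exact: closed_openC.
Qed.

Lemma continuous_measurable_rV g :
  continuous g -> measurable_fun setT (g : borelRV R d -> R).
Proof.
move=> cg; apply: (measurability _ (RGenOInfty.measurableE R)) => _ [_ [a ->] <-].
rewrite setTI; apply: open_measurable_rV.
apply: open_comp => [x _|]; first exact: cg.
exact: interval_open.
Qed.

Lemma norm_coord_le (x : 'rV[R]_d) i : `|x ord0 i| <= `|x|.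
Proof.
rewrite [leRHS]/Num.Def.normr/= mx_normrE.
by apply/bigmax_geP; right; exists (ord0, i).
Qed.

(** A non-zero sup norm is attained at some entry, and [0 <= t < |x|] makes it non-zero. *)
Lemma lt_norm_coord (x : 'rV[R]_d) (t : R) : 0 <= t ->
  t < `|x| -> exists i, t < `|x ord0 i|.
Proof.
move=> t0 tx; have x0 : mx_norm x != 0 by rewrite gt_eqF// (le_lt_trans t0 tx).
have [[i j] xij] := mx_norm_neq0 x0; exists j.
by move: tx; rewrite {1}/Num.Def.normr/= xij/= (ord1 i).
Qed.

(** Level sets of [g] are disjoint, so a finite measure charges only countably many of them; a
    countable set has Lebesgue measure 0 and cannot fill []a, b[]. *)
Lemma exists_null_level (mu : {measure set (borelRV R d) -> \bar R}) g (a b : R) :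
  continuous g -> a < b -> (mu [set x | (a <= g x)%R] < +oo)%E ->
  exists2 s, a < s < b & mu [set x | g x = s] = 0%E.
Proof.
move=> cg ab muD.
pose D : set (borelRV R d) := [set x | a <= g x].
have mg := continuous_measurable_rV cg.
have mgA (B : set R) : measurable B -> measurable ((g : borelRV R d -> R) @^-1` B).
  by move=> mB; rewrite -[X in measurable X]setTI; exact: mg.
have mD : measurable D.
  rewrite (_ : D = (g : borelRV R d -> R) @^-1` `[a, +oo[); first exact: mgA.
  by apply/seteqP; split => x /=; rewrite in_itv/= andbT.
have mL s : measurable ([set x | g x = s] : set (borelRV R d)) by exact: (mgA [set s]).
have [muD0|muD0] := eqVneq (mu D) 0%E.
  exists ((a + b) / 2); first by rewrite midf_lt// midf_lt.
  by apply: (subset_measure0 (mL _) mD) => // x /= gx; rewrite /D/= gx ltW// midf_lt.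
(* Normalising on [D] gives a probability, for which the atoms of the law of [g] are known to be
   countable. The Dirac mass is a default value that does not arise, the mass of [D] being positive
   and finite. *)
pose Q := mnormalize (mrestr mu mD) (dirac (0 : borelRV R d)).
pose gm : {mfun borelRV R d >-> R} :=
  HB.pack (g : borelRV R d -> R) (isMeasurableFun.Build _ _ _ _ _ mg).
have cQ := pmf_gt0_countable (P := Q) gm.
have [s sab sN] : exists2 s, s \in `]a, b[ & ~ (0 < @pmf _ _ _ Q gm s).
  apply: contrapT => h.
  have sub : `]a, b[%classic `<=` [set r | 0 < @pmf _ _ _ Q gm r].
    by move=> s sab /=; apply: contrapT => sN; apply: h; exists s.
  have := countable_lebesgue_measure0 (sub_countable (subset_card_le sub) cQ).
  rewrite lebesgue_measure_itv/= lte_fin ab => /eqP.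
  by rewrite -EFinB eqe subr_eq0 gt_eqF.
exists s; first by move: sab; rewrite in_itv.
have Dsub : [set x | g x = s] `<=` D.
  by move=> x /= gx; rewrite /D/= gx; move: sab; rewrite in_itv/= => /andP[/ltW].
have QE : Q [set x | g x = s] = (mu [set x | g x = s] * (fine (mu D))^-1%:E)%E.
  rewrite /Q /mnormalize/= /mrestr/= setTI (negbTE muD0)/= ifF.
    by rewrite (setIidl Dsub).
  by apply/negbTE; rewrite lt_eqF.
have muDfin : mu D \is a fin_num by rewrite ge0_fin_numE.
have : Q [set x | g x = s] = 0%E.
  apply/eqP; rewrite -fine_eq0 ?fin_num_measure//.
  by rewrite eq_le fine_ge0 ?measure_ge0// andbT leNgt; exact/negP.
rewrite QE => /eqP; rewrite mule_eq0 => /orP[/eqP//|].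
by rewrite eqe invr_eq0 fine_eq0// (negbTE muD0).
Qed.

End borel_rV.

(** * Tails of homogeneous functions of a regularly varying vector *)

Section regular_variation_tails.
Context {R : realType} {disp} {T : measurableType disp} (P : probability T R).

Section levels.
Context {d : nat} {X : T -> 'rV[R]_d} {b : R -> R}
  {mu : {measure set (borelRV R d) -> \bar R}}.
Hypothesis mX : measurable_fun setT (X : T -> borelRV R d).
Hypothesis mu_fin : forall A : set (borelRV R d),
  measurable A -> bounded_away0 A -> (mu A < +oo)%E.
Hypothesis mu_cvg : forall A : set (borelRV R d),
  measurable A -> bounded_away0 A -> mu (boundary A) = 0%E ->
  ((b t)%:E * P (X @^-1` dilate t A))%E @[t --> +oo] --> mu A.

(** Regular variation is applied to [A = {s < g}]. The boundary of [A] is contained in [{g = s}],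
    which is null for a suitable [s], and homogeneity identifies [dilate t A] with [{t * s < g}]. *)
Lemma superlevel_tail_cvg (g : 'rV[R]_d -> R) (K a c : R) :
  continuous g -> (forall t x, 0 < t -> g (t *: x) = t * g x) ->
  0 < K -> (forall x, `|g x| <= K * `|x|) -> 0 < a -> a < c ->
  exists s, [/\ a < s < c, (mu [set x | (s < g x)%R] < +oo)%E &
    b t * fine (P [set x | t * s < g (X x)]) @[t --> +oo] -->
    fine (mu [set x | s < g x])].
Proof.
move=> cg gZ K0 gK a0 ac.
have mg := continuous_measurable_rV cg.
have away (A : set 'rV[R]_d) : A `<=` [set x | a <= g x] -> bounded_away0 A.
  move=> Aa; exists (a / K); first exact: divr_gt0.
  move=> x /Aa/= agx; rewrite ler_pdivrMr// mulrC (le_trans _ (gK x))//.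
  by rewrite (le_trans agx)// ler_norm.
have clg s : closed [set x | s <= g x].
  rewrite (_ : [set x | _] = g @^-1` `[s, +oo[).
    by apply: closed_comp => [x _|]; [exact: cg|exact: interval_closed].
  by apply/seteqP; split => x /=; rewrite in_itv/= andbT.
have opg s : open [set x | s < g x].
  rewrite (_ : [set x | _] = g @^-1` `]s, +oo[).
    by apply: open_comp => [x _|]; [exact: cg|exact: interval_open].
  by apply/seteqP; split => x /=; rewrite in_itv/= andbT.
have mua : (mu [set x | (a <= g x)%R] < +oo)%E.
  by apply: mu_fin; [exact: closed_measurable_rV|exact: away].
have [s /andP[as_ sc] mus] := exists_null_level cg ac mua.
have s0 : 0 < s by lra.
have mA : measurable ([set x | s < g x] : set (borelRV R d)).
  exact: open_measurable_rV.
have bA : bounded_away0 [set x | s < g x].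
  by apply: away => x /= sx; apply: ltW; exact: lt_trans sx.
have muA : (mu [set x | (s < g x)%R] < +oo)%E by exact: mu_fin.
have bd : mu (boundary [set x | s < g x]) = 0%E.
  apply: subset_measure0 mus.
  - apply: measurableD.
      by apply: closed_measurable_rV; exact: closed_closure.
    by apply: open_measurable_rV; exact: open_interior.
  - rewrite (_ : [set x | _] = [set x | s <= g x] `\` [set x | s < g x]).
      by apply: measurableD => //; exact: closed_measurable_rV.
    apply/seteqP; split => x /= [].
      by move=> ->; split; [exact: lexx|rewrite ltxx].
    by move=> sx /negP; rewrite -leNgt => xs; apply/eqP; rewrite eq_le xs.
  have intS := (interior_id _).1 (opg s).
  move=> x [clx]; rewrite intS /= => /negP.
  rewrite -leNgt => gs; apply/eqP; rewrite eq_le gs/=.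
  have : closure [set x | s < g x] `<=` [set x | s <= g x].
    by rewrite closureE; apply: smallest_sub => // y /= /ltW.
  exact.
exists s; split => //; first by rewrite as_.
have muAfin : mu [set x | s < g x] \is a fin_num by rewrite ge0_fin_numE.
have := mu_cvg mA bA bd; rewrite -{1}(fineK muAfin) => /fine_cvg.
apply: cvg_trans; apply: near_eq_cvg; near=> t.
have t0 : 0 < t by near: t; apply: nbhs_pinfty_gt; exact: num_real.
rewrite /= (_ : X @^-1` dilate t _ = [set x | t * s < g (X x)]).
  by rewrite fineM// fin_num_measure//; apply: measurable_superlevel;
    exact: measurableT_comp mg mX.
apply/seteqP; split => x /=.
  by move=> [y /= sy <-]; rewrite gZ// ltr_pM2l.
move=> tsx; exists (t^-1 *: X x); last by rewrite scalerA mulfV ?gt_eqF// scale1r.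
by rewrite /= gZ ?invr_gt0// ltr_pdivlMl.
Unshelve. all: by end_near. Qed.

End levels.

Context {n : nat} {X : T -> 'rV[R]_n.+1}.
Hypothesis mX : measurable_fun setT (X : T -> borelRV R n.+1).
Hypothesis tail_right : forall i t,
  P [set x | t < X x ord0 i] = (cauchy_tail t)%:E.
Hypothesis tail_left : forall i t,
  P [set x | X x ord0 i < - t] = (cauchy_tail t)%:E.

Lemma measurable_comp_rV (g : 'rV[R]_n.+1 -> R) : continuous g ->
  measurable_fun setT (g \o X).
Proof. by move=> cg; apply: measurableT_comp mX; exact: continuous_measurable_rV. Qed.

(** A union bound over the two tails of each of the [n.+1] coordinates. *)
Lemma norm_tail_le (t : R) : 0 <= t ->
  fine (P [set x | t < `|X x|]) <= (n.+1 * 2)%:R * cauchy_tail t.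
Proof.
move=> t0.
have mc i : measurable_fun setT (fun x => X x ord0 i).
  exact: (measurable_comp_rV (@coord_continuous _ _ _ _ _)).
have mr i : measurable [set x | t < X x ord0 i] by exact: measurable_superlevel.
have ml i : measurable [set x | X x ord0 i < - t].
  rewrite (_ : [set x | _] = [set x | t < - X x ord0 i]).
    apply: measurable_superlevel; apply: measurableT_comp; last exact: mc.
    exact: oppr_measurable.
  by apply/seteqP; split => x /=; rewrite ltrNr.
(* The events are indexed by naturals through [inord], as [content_subadditive] expects a sequence
   of sets. *)
pose F k := [set x | t < X x ord0 (inord k)] `|` [set x | X x ord0 (inord k) < - t].
have mN : measurable [set x | t < `|X x|].
  apply: measurable_superlevel.
  exact: (measurable_comp_rV (@norm_continuous _ _)).
have sub : [set x | t < `|X x|] `<=` \big[setU/set0]_(k < n.+1) F k.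
  move=> x /= /(lt_norm_coord t0)[i]; rewrite ltr_normr => /orP ti.
  rewrite -bigcup_mkord; exists i => /=; first exact: ltn_ord.
  by rewrite /F inord_val; case: ti => ti; [left|right] => //=; rewrite ltrNr.
have mF k : measurable (F k) by exact: measurableU.
have := content_subadditive P (fun k _ => mF k) mN sub.
move=> PN; rewrite -lee_fin fineK ?fin_num_measure//; apply: le_trans PN _.
apply: (@le_trans _ _ (\sum_(k < n.+1) (cauchy_tail t *+ 2)%:E)%E).
  apply: lee_sum => k _; apply: (le_trans (measureU2 _ (mr _) (ml _))).
  rewrite mulr2n EFinD; apply: leeD.
    by rewrite -(tail_right (inord k)).
  by rewrite -(tail_left (inord k)).
by rewrite sumEFin lee_fin sumr_const card_ord -mulrnA mulr_natl mulnC.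
Qed.

Hypothesis X_rv : mreg_varying P X.

(* Along levels s charging no mass, [b t * P (t s < X_1)] and
   [pi * t * P (t s < X_1)] both converge, so that [b] is asymptotically linear;
   the slope is not zero since otherwise the union bound kills mu. *)
Lemma regular_variation_tail_cvg (g : 'rV[R]_n.+1 -> R) (K : R) :
  continuous g -> (forall t x, 0 < t -> g (t *: x) = t * g x) ->
  0 < K -> (forall x, `|g x| <= K * `|x|) ->
  exists l : R, t * fine (P [set x | t < g (X x)]) @[t --> +oo] --> l.
Proof.
move=> cg gZ K0 gK; have p0 := pi_gt0 R.
case: X_rv => _ [b [mu [b0 boo [mu0 muT] mu_fin mu_cvg]]].
have lt12 : 1 < 2 :> R by lra.
pose x1 (x : 'rV[R]_n.+1) := x ord0 ord0.
have cx1 : continuous x1 by exact: coord_continuous.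
have x1Z t x : 0 < t -> x1 (t *: x) = t * x1 x by move=> _; exact: mxE.
have x1K x : `|x1 x| <= 1 * `|x| by rewrite mul1r norm_coord_le.
have [s [/andP[s1 _] _]] := superlevel_tail_cvg mX mu_fin mu_cvg
  cx1 x1Z ltr01 x1K ltr01 lt12.
set q := fine (mu _) => c1.
have s0 : 0 < s by lra.
pose c := q * (pi * s).
have bt : b t / t @[t --> +oo] --> c.
  have tN0 : (pi * s)^-1 != 0 by rewrite invr_neq0// mulf_neq0// gt_eqF.
  have : (b t * fine (P [set x | t * s < x1 (X x)]))
      * (t * cauchy_tail (t * s))^-1 @[t --> +oo] --> c.
    rewrite /c -[X in _ * X]invrK; apply: cvgM => //.
    by apply: cvgV => //; exact: cvg_cauchy_tailMr.
  apply: cvg_trans; apply: near_eq_cvg; near=> t.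
  have t0 : 0 < t by near: t; apply: nbhs_pinfty_gt; exact: num_real.
  have /andP[k0 _] := cauchy_tail_itv (t * s).
  rewrite /= (_ : P _ = (cauchy_tail (t * s))%:E); last exact: tail_right.
  move: (cauchy_tail _) k0 => k k0 /=; field.
  by rewrite !gt_eqF.
have cN0 : c != 0.
  apply/eqP => c0; apply: muT.
  have null r : 0 < r -> mu [set x | r < `|x|] = 0%E.
    move=> r0; have r20 : 0 < r / 2 by rewrite divr_gt0.
    have r2r : r / 2 < r by lra.
    have nZ t (x : 'rV[R]_n.+1) : 0 < t -> `|t *: x| = t * `|x|.
      by move=> t0; rewrite normrZ gtr0_norm.
    have nK (x : 'rV[R]_n.+1) : `| `|x| | <= 1 * `|x| by rewrite normr_id mul1r.
    have [r' [/andP[rr' r'r] mfin c2]] := superlevel_tail_cvg mX mu_fin mu_cvg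
      (@norm_continuous _ _) nZ ltr01 nK r20 r2r.
    have r'0 : 0 < r' by lra.
    (* With slope [c = 0] this bound from [norm_tail_le] tends to 0, which forces [mu] to vanish on
       [{r' < |x|}]. *)
    have up : (n.+1 * 2)%:R * (b t / t * (t * cauchy_tail (t * r'))) @[t --> +oo]
        --> (0 : R).
      have := cvgM (cvg_cst ((n.+1 * 2)%:R : R)) (cvgM bt (cvg_cauchy_tailMr r'0)).
      by rewrite c0 mul0r mulr0; apply.
    have c20 : b t * fine (P [set x | t * r' < `|X x|]) @[t --> +oo] --> (0 : R).
      apply: squeeze_cvgr (cvg_cst 0) up; near=> t.
      have t0 : 0 < t by near: t; apply: nbhs_pinfty_gt; exact: num_real.
      rewrite mulr_ge0 ?fine_ge0 ?(ltW (b0 _ t0))//=.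
      apply: (le_trans (ler_wpM2l (ltW (b0 _ t0)) (norm_tail_le _))).
        by rewrite mulr_ge0// ltW.
      rewrite le_eqVlt; apply/orP; left; apply/eqP.
      move: (cauchy_tail _) (_%:R) => k k'; field.
      by rewrite gt_eqF.
    have f0 : fine (mu [set x | r' < `|x|]) = 0.
      exact: (cvg_unique (@Rhausdorff R) c2 c20).
    have mU a : measurable ([set x | a < `|x|] : set (borelRV R n.+1)).
      apply: measurable_superlevel; apply: continuous_measurable_rV.
      exact: norm_continuous.
    apply: (subset_measure0 (mU _) (mU r')) => [x /=|]; first exact: lt_trans.
    by apply/eqP; rewrite -fine_eq0 ?ge0_fin_numE//; exact/eqP.
  (* The whole space is covered by the origin and the countably many null sets [{1 / k.+1 < |x|}],
     contradicting that [mu] is non-zero. *)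
  apply/negligibleP => //.
  apply: (@negligibleS _ _ _ _
     (\bigcup_k ([set x | k.+1%:R^-1 < `|x|] `|` [set 0] : set (borelRV R n.+1)))).
    move=> x _; have [->|x0] := eqVneq x 0; first by exists 0%N => //; right.
    have : 0 < `|x : 'rV[R]_n.+1| by rewrite normr_gt0.
    by move=> /ltr_add_invr[k]; rewrite add0r => kx; exists k => //; left.
  apply: negligible_bigcup => k; apply: negligibleU; apply/negligibleP => //.
  - apply: measurable_superlevel; apply: continuous_measurable_rV.
    exact: norm_continuous.
  - by apply: null; rewrite invr_gt0.
  - apply: closed_measurable_rV; apply: accessible_closed_set1.
    by apply: hausdorff_accessible; exact: norm_hausdorff.
have [r [/andP[r1 _] _]] := superlevel_tail_cvg mX mu_fin mu_cvg cg gZ K0 gK ltr01 lt12.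
set m := fine (mu _) => c2.
have r0 : 0 < r by lra.
(* Dividing the limit [m] by the slope [c] of [b] gives the limit of [t * P(t r < g(X))];
   substituting [t / r] for [t] brings in the factor [r]. *)
exists (r * (m / c)).
have c3 : r * (t * fine (P [set x | t * r < g (X x)])) @[t --> +oo] --> r * (m / c).
  apply: cvgM; first exact: cvg_cst.
  have : (b t * fine (P [set x | t * r < g (X x)])) * (b t / t)^-1
      @[t --> +oo] --> m / c by apply: cvgM => //; exact: cvgV.
  apply: cvg_trans; apply: near_eq_cvg; near=> t.
  have t0 : 0 < t by near: t; apply: nbhs_pinfty_gt; exact: num_real.
  have bt0 := b0 _ t0.
  rewrite /=; move: (fine _) => k; field.
  by rewrite !gt_eqF.
have rV0 : 0 < r^-1 by rewrite invr_gt0.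
have := cvg_pinftyMr rV0 c3.
apply: cvg_trans; apply: near_eq_cvg; near=> t => /=.
rewrite divfK ?gt_eqF//; move: (fine _) => k; field.
by rewrite gt_eqF.
Unshelve. all: by end_near. Qed.

End regular_variation_tails.

(** * Norms, and the defect of convexity of the positive part *)

(** Inversion is continuous on the open set of non-zero reals, and the remaining point is a
    measurable singleton. *)
Lemma measurable_invr {R : realType} : measurable_fun setT (GRing.inv : R -> R).
Proof.
have -> : setT = [set y : R | y != 0] `|` [set 0].
  apply/esym/seteqP; split => // y _ /=.
  by have [->|y0] := eqVneq y 0; [right|left].
have opn : open [set y : R | y != 0].
  rewrite (_ : [set _ | _] = ~` [set 0]).
    apply: closed_openC; apply: accessible_closed_set1.
    exact: hausdorff_accessible (@Rhausdorff R).
  by apply/seteqP; split => y /= /eqP.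
apply/measurable_funU => //; first exact: open_measurable.
split; last exact: measurable_fun_set1.
apply: open_continuous_measurable_fun => // y; rewrite inE/= => y0.
exact: inv_continuous.
Qed.

Section norm_equivalence.
Context {R : realType} {n : nat} (N : 'rV[R]_n -> R).
Hypothesis N_norm : is_norm N.

Lemma is_norm0 : N 0 = 0.
Proof. by have [_ NZ _] := N_norm; rewrite -(scale0r 0) NZ normr0 mul0r. Qed.

Lemma is_norm_ge0 x : 0 <= N x.
Proof.
have [ND NZ _] := N_norm.
have := ND x (- x); rewrite subrr is_norm0 -scaleN1r NZ normrN1 mul1r.
by rewrite -mulr2n pmulrn_lge0.
Qed.

Lemma is_norm_ub : exists2 C, 0 < C & forall x, N x <= C * `|x|.
Proof.
have [ND NZ _] := N_norm.
(* The triangle inequality in the canonical basis gives the sum; adding 1 keeps the constant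
   positive. *)
exists (\sum_(j < n) N 'e_j + 1).
  by rewrite ltr_wpDl// sumr_ge0// => j _; exact: is_norm_ge0.
move=> x; rewrite {1}(row_sum_delta x).
apply: (@le_trans _ _ (\sum_(j < n) N (x 0 j *: 'e_j))).
  elim/big_ind2 : _ => [|y u z v yu zv|//]; first by rewrite is_norm0.
  by rewrite (le_trans (ND _ _))// lerD.
rewrite mulrDl mul1r -[leLHS]addr0 lerD// mulr_suml.
apply: ler_sum => j _; rewrite NZ mulrC ler_wpM2l ?is_norm_ge0//.
exact: norm_coord_le.
Qed.

Lemma is_norm_continuous : continuous N.
Proof.
have [ND NZ _] := N_norm; have [C C0 NC] := is_norm_ub.
have sub x y : N x - N y <= C * `|x - y|.
  by rewrite lerBlDr (le_trans _ (lerD (NC _) (lexx _)))// -{1}(subrK y x).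
move=> x; apply/(@cvgrPdist_le _ _ _ (nbhs x) _ N) => e e0.
apply: (iffRL (@nbhs_normP R 'rV[R]_n x (fun y => `|N x - N y| <= e))).
exists (e / C) => [|y /= /ltW xy]; first exact: divr_gt0.
have xyC : C * `|x - y| <= e by rewrite mulrC -ler_pdivlMr.
rewrite ler_norml lerNl opprB; apply/andP; split; apply: le_trans xyC => //.
by rewrite distrC; exact: sub.
Qed.

End norm_equivalence.

(** [N] attains its minimum on the compact sup-norm sphere, and this minimum is positive because [N]
    vanishes only at 0. Dimension [n.+1] makes the sphere non-empty. *)
Lemma is_norm_lb {R : realType} {n : nat} (N : 'rV[R]_n.+1 -> R) : is_norm N ->
  exists2 K, 1 <= K & forall x, `|x| <= K * N x.
Proof.
move=> N_norm; have [ND NZ N0] := N_norm.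
pose S : set 'rV[R]_n.+1 := [set x | `|x| = 1].
have nrm (x : 'rV[R]_n.+1) : x != 0 -> S (`|x|^-1 *: x).
  move=> x0; rewrite /S/= normrZ ger0_norm ?invr_ge0// mulVf//.
  by rewrite normr_eq0.
have S0 : S !=set0.
  exists (`|const_mx 1 : 'rV[R]_n.+1|^-1 *: const_mx 1); apply: nrm.
  apply/eqP => /matrixP/(_ ord0 ord0); rewrite !mxE => /eqP.
  by rewrite oner_eq0.
have cS : compact S.
  apply: bounded_closed_compact.
    by exists 1; split => // M M1 x /= ->; exact: ltW.
  rewrite (_ : S = Num.norm @^-1` [set 1]).
    apply: closed_comp => [x _|]; first exact: norm_continuous.
    apply: accessible_closed_set1.
    exact: hausdorff_accessible (@Rhausdorff R).
  by [].
have cN : {within S, continuous N}.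
  exact/continuous_subspaceT/is_norm_continuous.
have [c cS' cmin] := EVT_min_rV S0 cS cN.
have Nc0 : 0 < N c.
  rewrite lt_neqAle is_norm_ge0// andbT eq_sym; apply/eqP => /N0 c0.
  by move: cS'; rewrite inE /S/= c0 normr0 => /eqP; rewrite eq_sym oner_eq0.
(* The maximum with 1 supplies the hypothesis [1 <= K] of [sum_tail_approx]. *)
exists (Num.max 1 (N c)^-1); first by rewrite le_max lexx.
move=> x; have [->|x0] := eqVneq x 0.
  by rewrite normr0 mulr_ge0 ?is_norm_ge0// le_max ler01.
have := cmin (`|x|^-1 *: x); rewrite inE => /(_ (nrm _ x0)).
have nx0 : 0 < `|x| by rewrite normr_gt0.
rewrite NZ ger0_norm ?invr_ge0// mulrC ler_pdivlMr// => Nx.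
apply: (@le_trans _ _ ((N c)^-1 * N x)).
  by rewrite mulrC ler_pdivlMr// mulrC.
by rewrite ler_wpM2r ?is_norm_ge0// le_max lexx orbT.
Qed.

Lemma continuous_sum {R : numFieldType} (V : topologicalType) (I : Type)
    (r : seq I) (f : I -> V -> R) : (forall i, continuous (f i)) ->
  continuous (fun x => \sum_(i <- r) f i x).
Proof.
move=> cf; elim: r => [|i r IH] x.
  rewrite (_ : (fun y => _) = cst 0); first exact: cvg_cst.
  by apply/funext => y; rewrite big_nil.
rewrite (_ : (fun y => _) = (fun y => f i y + \sum_(j <- r) f j y)).
  by apply: cvgD; [exact: cf|exact: IH].
by apply/funext => y; rewrite big_cons.
Qed.

Section sign_defect.
Context {R : realType} {n : nat} (w : 'I_n -> R).
Hypothesis w_ge0 : forall i, 0 <= w i.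

(** For weights of sum 1 this is the gap in Jensen's inequality for the positive part, the function
    [f] of the idea of the proof. *)
Definition sign_defect (x : 'rV[R]_n) : R :=
  \sum_i w i * Num.max (x ord0 i) 0 - Num.max (weighted_sum w x) 0.

Lemma continuous_weighted_sum : continuous (weighted_sum w).
Proof.
apply: (continuous_sum (f := fun i (y : 'rV[R]_n) => w i * y ord0 i)) => i x.
apply: (@continuousM _ _ (cst (w i)) (fun y : 'rV[R]_n => y ord0 i)).
  exact: cst_continuous.
exact: coord_continuous.
Qed.

Lemma weighted_sumZ t x : weighted_sum w (t *: x) = t * weighted_sum w x.
Proof.
by rewrite /weighted_sum mulr_sumr; apply: eq_bigr => i _; rewrite mxE mulrCA.
Qed.

Lemma weighted_sum_le_pos x :
  Num.max (weighted_sum w x) 0 <= \sum_i w i * Num.max (x ord0 i) 0.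
Proof.
rewrite ge_max; apply/andP; split.
  by apply: ler_sum => i _; rewrite ler_wpM2l// le_max lexx.
by apply: sumr_ge0 => i _; rewrite mulr_ge0// le_max lexx orbT.
Qed.

Lemma sign_defect_ge0 x : 0 <= sign_defect x.
Proof. by rewrite subr_ge0 weighted_sum_le_pos. Qed.

Lemma sign_defectZ t x : 0 <= t -> sign_defect (t *: x) = t * sign_defect x.
Proof.
move=> t0; rewrite /sign_defect weighted_sumZ mulrBr maxr_pMr// mulr0.
congr (_ - _); rewrite mulr_sumr; apply: eq_bigr => i _.
rewrite mxE [RHS]mulrCA.
by rewrite (maxr_pMr _ _ t0) mulr0.
Qed.

Lemma continuous_sign_defect : continuous sign_defect.
Proof.
have cmax (g : 'rV[R]_n -> R) : continuous g -> continuous (fun x => Num.max (g x) 0).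
  move=> cg x; apply: (@continuous_max _ _ g (cst 0)); first exact: cg.
  exact: cst_continuous.
have csum : continuous (fun x : 'rV[R]_n => \sum_i w i * Num.max (x ord0 i) 0).
  apply: (continuous_sum (f := fun i (y : 'rV[R]_n) => w i * Num.max (y ord0 i) 0)).
  move=> i x.
  apply: (@continuousM _ _ (cst (w i)) (fun y : 'rV[R]_n => Num.max (y ord0 i) 0)).
    exact: cst_continuous.
  exact: cmax (@coord_continuous _ _ _ _ _) x.
move=> x; exact: (continuousB (csum x) (cmax _ continuous_weighted_sum x)).
Qed.

Lemma same_sign_sign_defect x : same_sign_orthants x -> sign_defect x = 0.
Proof.
move=> [] xs; apply/eqP; rewrite subr_eq0; apply/eqP.
  rewrite big1 => [|i _]; last by rewrite max_r// mulr0.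
  rewrite max_r//; apply: sumr_le0 => i _; exact: mulr_ge0_le0.
rewrite max_l; last by apply: sumr_ge0 => i _; exact: mulr_ge0.
by apply: eq_bigr => i _; rewrite max_l.
Qed.

(** If the weighted sum is at most 0, the non-negative terms [w i * x_i^+] add up to 0; otherwise
    the terms [w i * (x_i^+ - x_i)] do. Positive weights then fix the sign of every coordinate. *)
Lemma sign_defect_same_sign x : (forall i, 0 < w i) ->
  sign_defect x = 0 -> same_sign_orthants x.
Proof.
move=> w0 /eqP; rewrite subr_eq0; have [Tx|Tx] := leP (weighted_sum w x) 0.
  rewrite psumr_eq0 => [/allP h|i _]; last by rewrite mulr_ge0// le_max lexx orbT.
  left=> i; have := h i (mem_index_enum _); rewrite mulf_eq0 gt_eqF//= => /eqP <-.
  by rewrite le_max lexx.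
rewrite -subr_eq0 -sumrB; rewrite psumr_eq0 => [/allP h|i _]; last first.
  by rewrite -mulrBr mulr_ge0// subr_ge0 le_max lexx.
right=> i; have := h i (mem_index_enum _).
rewrite -mulrBr mulf_eq0 gt_eqF//= subr_eq0 => /eqP <-.
by rewrite le_max lexx orbT.
Qed.

End sign_defect.

Lemma measurable_same_sign_orthants {R : realType} (n : nat) :
  measurable (same_sign_orthants : set (borelRV R n)).
Proof.
(* With all weights equal to 1, the two orthants are the zero set of a continuous function. *)
rewrite (_ : same_sign_orthants =
    (sign_defect (fun=> 1) : borelRV R n -> R) @^-1` [set 0]).
  rewrite -[X in measurable X]setTI.
  apply: continuous_measurable_rV => //.
  by apply: continuous_sign_defect.
apply/seteqP; split => x /=; first exact: same_sign_sign_defect.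
exact: sign_defect_same_sign.
Qed.

Lemma sign_defect_le_norm {R : realType} {n : nat} (w : 'I_n -> R) (x : 'rV[R]_n) :
  (forall i, 0 <= w i) -> \sum_i w i = 1 -> sign_defect w x <= `|x|.
Proof.
move=> w0 w1; apply: (@le_trans _ _ (\sum_i w i * Num.max (x ord0 i) 0)).
  by rewrite /sign_defect lerBlDr lerDl le_max lexx orbT.
rewrite -[leRHS]mul1r -w1 mulr_suml; apply: ler_sum => i _.
rewrite ler_wpM2l// ge_max normr_ge0 andbT.
exact: le_trans (ler_norm _) (norm_coord_le _ _).
Qed.

(** * The integral of the defect against the angular measure *)

Section angular_integral.
Context {R : realType} {n : nat} (N : 'rV[R]_n.+1 -> R) (w : 'I_n.+1 -> R)
  (sigma : probability (borelRV R n.+1) R).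
Hypothesis N_norm : is_norm N.
Hypothesis w_ge0 : forall i, 0 <= w i.
Hypothesis w_sum1 : \sum_i w i = 1.
Hypothesis sigma_sphere : sigma (sphere N) = 1%E.

Local Notation defect := (\int[sigma]_(x in sphere N) sign_defect w x).

Lemma measurable_sphere : measurable (sphere N : set (borelRV R n.+1)).
Proof.
have mN := continuous_measurable_rV (is_norm_continuous N_norm).
by rewrite -[X in measurable X]setTI; exact: (mN _ [set 1]).
Qed.

Lemma sign_defect_integral_ge0 : 0 <= defect.
Proof. by apply: Rintegral_ge0 => x _; exact: sign_defect_ge0. Qed.

Lemma measurable_sign_defect :
  measurable_fun setT (sign_defect w : borelRV R n.+1 -> R).
Proof. by apply: continuous_measurable_rV; exact: continuous_sign_defect. Qed.

Lemma measurable_sphere_defect :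
  measurable (sphere N `&` [set x | sign_defect w x != 0] : set (borelRV R n.+1)).
Proof.
apply: measurableI; first exact: measurable_sphere.
rewrite (_ : [set _ | _] = (sign_defect w : borelRV R n.+1 -> R) @^-1` (~` [set 0])).
  rewrite -[X in measurable X]setTI; apply: measurable_sign_defect => //.
  exact: measurableC.
by apply/seteqP; split => x /= /eqP.
Qed.

Lemma sign_defect_integral_eq0 : defect = 0 <->
  sigma (sphere N `&` [set x | sign_defect w x != 0]) = 0%E.
Proof.
have mS := measurable_sphere.
have mf : measurable_fun (sphere N : set (borelRV R n.+1)) (EFin \o sign_defect w).
  by apply/measurable_EFinP/measurable_funTS; exact: measurable_sign_defect.
have mD := measurable_sphere_defect.
have int0 : defect = 0 <->
    (\int[sigma]_(x in sphere N) `|(EFin \o sign_defect w) x|)%E = 0%E.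
  under [X in _ <-> X = _]eq_integral => x _.
    rewrite /= ger0_norm; last exact: sign_defect_ge0.
    over.
  split=> [/eqP|I0]; last by rewrite /Rintegral I0.
  (* Since [fine] also sends infinity to 0, the integral has to be shown finite; on the sphere the
     defect is at most [K]. *)
  rewrite /Rintegral fine_eq0; first by move/eqP.
  have [K K1 NK] := is_norm_lb N_norm.
  have int : sigma.-integrable (sphere N) (EFin \o sign_defect w).
    apply: measurable_bounded_integrable => //.
    - exact: le_lt_trans (probability_le1 sigma mS) (ltry _).
    - by apply/measurable_funTS; exact: measurable_sign_defect.
    exists K; split; first exact: num_real.
    move=> M KM x Nx /=; rewrite ger0_norm; last exact: sign_defect_ge0.
    apply: le_trans (ltW KM); apply: (le_trans (sign_defect_le_norm _ _ _)) => //.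
    by rewrite (le_trans (NK x))// Nx mulr1.
  exact: integrable_fin_num.
rewrite int0 (ae_eq_integral_abs _ mS mf) -(negligibleP _ mD).
split=> [[A [mA A0 sub]]|[A [mA A0 sub]]]; exists A; split=> // x.
  move=> [Sx /= fx]; apply: sub => /= /(_ Sx) [fx0].
  by rewrite fx0 eqxx in fx.
move=> /= h; apply: sub; split => /=.
  by apply: contrapT => Sx; apply: h.
by apply/eqP => fx; apply: h => _; rewrite fx.
Qed.

Lemma sign_defect_integral_same_sign :
  sigma same_sign_orthants = 1%E -> defect = 0.
Proof.
move=> s1; apply/sign_defect_integral_eq0.
have mO := @measurable_same_sign_orthants R n.+1.
have : sigma (~` same_sign_orthants) = 0%E by rewrite probability_setC// s1 subee.
apply: subset_measure0.
- exact: measurable_sphere_defect.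
- exact: measurableC.
by move=> x [_ /= fx] /(same_sign_sign_defect w_ge0) fx0; rewrite fx0 eqxx in fx.
Qed.

Lemma same_sign_sign_defect_integral : (forall i, 0 < w i) ->
  defect = 0 -> sigma same_sign_orthants = 1%E.
Proof.
move=> w0 /sign_defect_integral_eq0 f0.
have mO := @measurable_same_sign_orthants R n.+1.
apply/eqP; rewrite eq_le probability_le1//=.
have mS := measurable_sphere.
rewrite -sigma_sphere (measureDI _ mS mO) (subset_measure0 _ _ _ f0) ?add0e.
- by apply: le_measure => //; rewrite ?inE//; exact: measurableI.
- exact: measurableD.
- exact: measurable_sphere_defect.
move=> x [Sx nx]; split => //=; apply/eqP => fx.
by apply: nx; exact: (sign_defect_same_sign w_ge0).
Qed.

End angular_integral.

(** * The limit of the tail ratio *)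

Lemma limf_esup_le {R : realType} (f : R -> R) (l M : R) :
  f t @[t --> +oo] --> l -> l <= M ->
  (limf_esup (fun t => (f t)%:E) (+oo%R : set_system R) <= M%:E)%E.
Proof.
move=> fl lM; apply/lee_addgt0Pr => e e0.
apply: ge_ereal_inf; have ltle : l < l + e by rewrite ltrDl.
(* The upper limit is an infimum of suprema over sets of the filter; the set where [f] is at most
   [l + e] is one of them. *)
exists (ereal_sup ((fun t => (f t)%:E) @` [set t | f t <= l + e])).
  exists [set t | f t <= l + e] => //.
  exact: (cvgr_le l fl _ ltle).
apply: ge_ereal_sup => _ [t /= ft <-].
by rewrite -EFinD lee_fin (le_trans ft)// lerD2r.
Qed.

Lemma near_pinfty_nat {R : realType} (Q : R -> Prop) :
  (\forall t \near +oo, Q t) -> \forall k \near \oo, Q k.+1%:R.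
Proof.
move=> Qoo; have kS : (k.+1%:R : R) @[k --> \oo] --> +oo.
  apply/cvgryPge => A; near=> k.
  have : A <= k%:R by near: k; exact: nbhs_infty_ger.
  by move/le_trans; apply; rewrite ler_nat.
exact: (kS _ Qoo).
Unshelve. all: by end_near. Qed.

Lemma is_norm_normr {R : realType} (n : nat) : is_norm (@Num.norm R 'rV[R]_n).
Proof.
split=> [x y|a x|x /eqP]; [exact: ler_normD|exact: normrZ|].
by rewrite normr_eq0 => /eqP.
Qed.

(** * Comparison of the summed tails *)

Section core.
Context {R : realType} {disp} {T : measurableType disp} (P : probability T R).
Context {n : nat} {X : T -> 'rV[R]_n.+1} (w : 'I_n.+1 -> R).
Hypothesis w_ge0 : forall i, 0 <= w i.
Hypothesis w_sum1 : \sum_i w i = 1.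
Hypothesis mX : measurable_fun setT (X : T -> borelRV R n.+1).
Hypothesis tail_right : forall i t,
  P [set x | t < X x ord0 i] = (cauchy_tail t)%:E.
Hypothesis tail_left : forall i t,
  P [set x | X x ord0 i < - t] = (cauchy_tail t)%:E.

Section with_norm.
Variable N : 'rV[R]_n.+1 -> R.
Hypothesis N_norm : is_norm N.

Local Notation defect_mass t :=
  (\int[P]_(x in [set x | t < N (X x)]) sign_defect w ((N (X x))^-1 *: X x)).

Lemma measurable_norm_tail t : measurable [set x | t < N (X x)].
Proof.
apply: measurable_superlevel.
exact: (measurable_comp_rV mX (is_norm_continuous N_norm)).
Qed.

(** By [N x <= C * |x|] the tail of [N] is at most that of the sup norm at [t / C], to which the
    union bound applies. With [is_norm_tail_lb] this places [P(N(X) > t)] at exact order [1 / t]. *)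
Lemma is_norm_tail_ub : exists2 D, 0 < D &
  forall t, 0 < t -> t * fine (P [set x | t < N (X x)]) <= D.
Proof.
have p0 := pi_gt0 R; have [C C0 NC] := is_norm_ub N_norm.
have n0 : 0 < (n.+1 * 2)%:R :> R by rewrite ltr0n.
exists (C * (n.+1 * 2)%:R / pi); first by rewrite divr_gt0// mulr_gt0.
move=> t t0; have tC : 0 < t / C by rewrite divr_gt0.
have sub : fine (P [set x | t < N (X x)]) <= fine (P [set x | t / C < `|X x|]).
  have mt : measurable [set x | t / C < `|X x|].
    apply: measurable_superlevel.
    exact: (measurable_comp_rV mX (@norm_continuous _ _)).
  apply: fine_le; rewrite ?fin_num_measure//; try exact: measurable_norm_tail.
  apply: le_measure; rewrite ?inE//; first exact: measurable_norm_tail.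
  by move=> x /= tN; rewrite ltr_pdivrMr// mulrC (lt_le_trans tN).
have := norm_tail_le mX tail_right tail_left (ltW tC).
have /andP[_] := cauchy_tail_bounds tC.
move: sub; set a := fine _; set b := fine _; set k := cauchy_tail _.
move=> ab ub bk; have kub : t * k <= C / pi.
  have aux (p : R) : t * k * p = p * (t / C) * k * C by field; rewrite gt_eqF.
  by rewrite ler_pdivlMr// aux -[leRHS]mul1r ler_wpM2r// ltW.
have : t * a <= t * ((n.+1 * 2)%:R * k).
  by apply: ler_wpM2l; [exact: ltW|exact: le_trans ab bk].
move/le_trans; apply; rewrite mulrCA [leRHS]mulrAC [leRHS]mulrC.
by rewrite ler_wpM2l// ltW.
Qed.

Lemma is_norm_tail_lb : exists2 K, 0 < K &
  forall t, 0 < t -> cauchy_tail (t * K) <= fine (P [set x | t < N (X x)]).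
Proof.
have [K K1 NK] := is_norm_lb N_norm.
have K0 : 0 < K by lra.
exists K => // t t0.
rewrite -lee_fin fineK ?fin_num_measure//; last exact: measurable_norm_tail.
rewrite -(tail_right ord0); apply: le_measure; rewrite ?inE.
- apply: measurable_superlevel.
  exact: (measurable_comp_rV mX (@coord_continuous _ _ _ _ _)).
- exact: measurable_norm_tail.
move=> x /= tX; rewrite -(ltr_pM2r K0) (lt_le_trans tX)// mulrC.
by rewrite (le_trans _ (NK _))// (le_trans (ler_norm _))// norm_coord_le.
Qed.

(** This is [sum_tail_approx] with [h] the defect at the angle. The marginal tails coincide and the
    weights sum to 1, so their weighted mean is [cauchy_tail]. *)
Lemma sum_tail_defect_bound : exists B, forall m,
  `| \sum_(k < m) (cauchy_tail k.+1%:R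
       - fine (P [set x | k.+1%:R < weighted_sum w (X x)])
       - defect_mass k.+1%:R) | <= B.
Proof.
have [D D0 ND] := is_norm_tail_ub; have [K K1 NK] := is_norm_lb N_norm.
have K0 : 0 < K by lra.
have cN := is_norm_continuous N_norm.
have mN : measurable_fun setT (N \o X) by exact: measurable_comp_rV.
have hE x : sign_defect w ((N x)^-1 *: x) = (N x)^-1 * sign_defect w x.
  by rewrite sign_defectZ// invr_ge0 is_norm_ge0.
have f0 x : 0 <= sign_defect w x by exact: sign_defect_ge0.
have fN x : sign_defect w x <= K * N x.
  by apply: le_trans (NK x); exact: sign_defect_le_norm.
have mh : measurable_fun setT (fun x => sign_defect w ((N (X x))^-1 *: X x)).
  under eq_fun do rewrite hE.
  apply: measurable_funM.
    exact: measurableT_comp measurable_invr mN.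
  exact: (measurable_comp_rV mX (@continuous_sign_defect _ _ _)).
have mY i : measurable_fun setT (fun x => X x ord0 i).
  exact: (measurable_comp_rV mX (@coord_continuous _ _ _ _ _)).
have N0 x : 0 <= N x by exact: is_norm_ge0.
(* The bound [D] at level [m / K] gives [m * P(m < K * N(X)) <= K * D]. *)
exists ((1 + K) * (1 + K * D)) => m.
have := sum_tail_approx (h := fun x => sign_defect w ((N (X x))^-1 *: X x)) P m
  w_ge0 w_sum1 K1 mY mN mh (fun x => N0 (X x)).
have -> : \sum_(k < m) (\sum_i w i * fine (P [set x | k.+1%:R < X x ord0 i])
    - fine (P [set x | k.+1%:R < \sum_i w i * X x ord0 i]) - defect_mass k.+1%:R)
  = \sum_(k < m) (cauchy_tail k.+1%:R
       - fine (P [set x | k.+1%:R < weighted_sum w (X x)])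
       - defect_mass k.+1%:R).
  apply: eq_bigr => k _; congr (_ - _ - _).
  under eq_bigr do rewrite tail_right/=.
  by rewrite -mulr_suml w_sum1 mul1r.
move=> h; apply: (le_trans (h _ _ _)).
- by move=> x i; rewrite (le_trans _ (NK _))// norm_coord_le.
- move=> x; rewrite hE mulr_ge0 ?invr_ge0//=.
  (* Where [N] vanishes, the inverse is 0 by convention, so the angle and its defect are 0. *)
  have [Nx0|Nx0] := eqVneq (N (X x)) 0.
    by rewrite Nx0 invr0 mul0r ltW.
  by rewrite mulrC ler_pdivrMr// lt_neqAle eq_sym Nx0 N0.
- move=> x; rewrite hE.
  have [Nx0|Nx0] := eqVneq (N (X x)) 0; last by rewrite mulrAC mulVf// mul1r.
  have fX0 : sign_defect w (X x) = 0.
    by apply/eqP; rewrite eq_le f0 andbT (le_trans (fN _))// Nx0 mulr0.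
  by rewrite fX0 mulr0 mul0r; exact: esym fX0.
rewrite ler_pM2l; last by lra.
rewrite lerD2l; case: m {h} => [|m]; first
  by rewrite mul0r; apply: mulr_ge0; apply: ltW.
have m0 : 0 < m.+1%:R / K by rewrite divr_gt0.
have -> : [set x | m.+1%:R < K * N (X x)] = [set x | m.+1%:R / K < N (X x)].
  by apply/seteqP; split => x /=; rewrite ltr_pdivrMr// mulrC.
by rewrite -ler_pdivrMl// mulrA [_^-1 * _]mulrC; exact: ND.
Qed.

Lemma defect_mass_ge0 t : 0 <= defect_mass t.
Proof. by apply: Rintegral_ge0 => x _; exact: sign_defect_ge0. Qed.

Lemma defect_massE t : 0 < t -> defect_mass t =
  cond_angle_mean P X N (sign_defect w) t * fine (P [set x | t < N (X x)]).
Proof.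
move=> t0; have [K K0 lb] := is_norm_tail_lb.
rewrite /cond_angle_mean divfK// gt_eqF// (lt_le_trans _ (lb _ t0))//.
by have /andP[] := cauchy_tail_itv (t * K).
Qed.

End with_norm.

Variable l : R.
Hypothesis weighted_tail :
  t * fine (P [set x | t < weighted_sum w (X x)]) @[t --> +oo] --> l.

Lemma cvg_tail_gap : t * (cauchy_tail t
  - fine (P [set x | t < weighted_sum w (X x)])) @[t --> +oo] --> pi^-1 - l.
Proof.
under eq_fun do rewrite mulrBr.
by apply: cvgB => //; exact: cvg_mul_cauchy_tail.
Qed.

(** Otherwise the gaps between the two tails are eventually below a negative multiple of [1 / k],
    while their sums are bounded below because the defect masses are non-negative. The sup norm
    serves as [N]. *)
Lemma weighted_tail_le : l <= pi^-1.
Proof.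
have [B BP] := sum_tail_defect_bound (@is_norm_normr R n.+1).
rewrite leNgt; apply/negP => l_gt.
have dl0 : 0 < (l - pi^-1) / 2 by lra.
apply: (@sum_le_harmonicN_unbounded R (fun k => cauchy_tail k.+1%:R
       - fine (P [set x | k.+1%:R < weighted_sum w (X x)])) _ B dl0).
  have gap := near_pinfty_nat (cvgr_le _ cvg_tail_gap (- ((l - pi^-1) / 2)) _).
  near=> k; rewrite -mulNr ler_pdivlMr// mulrC.
  by near: k; apply: gap; lra.
move=> m; have := BP m; rewrite sumrB ler_norml => /andP[+ _].
move/le_trans; apply; rewrite gerBl.
by apply: sumr_ge0 => k _; exact: defect_mass_ge0.
Unshelve. all: by end_near. Qed.

Section angular.
Variables (N : 'rV[R]_n.+1 -> R) (sigma : probability (borelRV R n.+1) R).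
Hypothesis N_norm : is_norm N.
Hypothesis X_sigma : angular_measure P X N sigma.

Let defect := \int[sigma]_(x in sphere N) sign_defect w x.

Lemma cvg_cond_defect :
  cond_angle_mean P X N (sign_defect w) t @[t --> +oo] --> defect.
Proof.
case: X_sigma => _; apply; apply: continuous_subspaceT.
exact: continuous_sign_defect.
Qed.

(** A zero integral makes the defect mass [o(1 / k)], so it could not compensate gaps of order
    [1 / k] if [l] were smaller than [pi^-1]. *)
Lemma weighted_tail_eq : defect = 0 -> l = pi^-1.
Proof.
move=> I0; apply/eqP; rewrite eq_le weighted_tail_le leNgt/=; apply/negP => l_lt.
have [D D0 DP] := is_norm_tail_ub N_norm.
have [B BP] := sum_tail_defect_bound N_norm.
(* Times [k], the gap is eventually at least [2 * dl] and the defect mass at most [dl], which leaves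
   [dl]. *)
pose dl := (pi^-1 - l) / 3.
have dl0 : 0 < dl by rewrite /dl; lra.
apply: (@sum_le_harmonicN_unbounded R (fun k => - (cauchy_tail k.+1%:R
  - fine (P [set x | k.+1%:R < weighted_sum w (X x)])
  - \int[P]_(x in [set x | k.+1%:R < N (X x)]) sign_defect w ((N (X x))^-1 *: X x)))
  _ B dl0).
  have gapP : 2 * dl < pi^-1 - l by rewrite /dl; lra.
  have gap := near_pinfty_nat (cvgr_ge _ cvg_tail_gap _ gapP).
  have condP : defect < dl / D by rewrite I0 divr_gt0.
  have cond := near_pinfty_nat (cvgr_le _ cvg_cond_defect _ condP).
  near=> k; have k0 : 0 < k.+1%:R :> R by [].
  rewrite -[leRHS]mulNr ler_pdivlMr// mulrC defect_massE//.
  have : 2 * dl <= k.+1%:R * (cauchy_tail k.+1%:R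
    - fine (P [set x | k.+1%:R < weighted_sum w (X x)])) by near: k; exact: gap.
  have : cond_angle_mean P X N (sign_defect w) k.+1%:R <= dl / D.
    by near: k; exact: cond.
  have := DP _ k0; set p := fine (P [set x | k.+1%:R < N (X x)]).
  have : 0 <= p by exact: fine_ge0.
  set c := cond_angle_mean _ _ _ _ _; set a := _ - fine _; set t := _.+1%:R.
  move=> p0 tpD cD ga.
  have : c * (t * p) <= dl.
    apply: (@le_trans _ _ (dl / D * (t * p))).
      by rewrite ler_wpM2r// mulr_ge0.
    by rewrite mulrAC ler_pdivrMr// ler_wpM2l// ltW.
  nra.
move=> m; have := BP m; rewrite sumrN ler_norml => /andP[_].
by rewrite lerN2.
Unshelve. all: by end_near. Qed.

(** If [l = pi^-1], the gaps are [o(1 / k)], whereas a positive integral keeps the defect mass at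
    least of order [1 / k]. *)
Lemma weighted_tail_neq : 0 < defect -> l != pi^-1.
Proof.
move=> I0; apply/eqP => l_eq; have p0 := pi_gt0 R.
have [K K0 KP] := is_norm_tail_lb N_norm.
have [B BP] := sum_tail_defect_bound N_norm.
pose kap := (pi * K)^-1 : R.
have kap0 : 0 < kap by rewrite invr_gt0 mulr_gt0.
(* Times [k], the defect mass is eventually at least [(defect / 2) * (kap / 2) = 2 * dl] and the gap
   at most [dl]. *)
pose dl := defect * kap / 8.
have dl0 : 0 < dl by rewrite divr_gt0// mulr_gt0.
apply: (@sum_le_harmonicN_unbounded R (fun k => cauchy_tail k.+1%:R
  - fine (P [set x | k.+1%:R < weighted_sum w (X x)])
  - \int[P]_(x in [set x | k.+1%:R < N (X x)]) sign_defect w ((N (X x))^-1 *: X x))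
  _ B dl0).
  have gapP : pi^-1 - l < dl by rewrite l_eq subrr.
  have gap := near_pinfty_nat (cvgr_le _ cvg_tail_gap _ gapP).
  have condP : defect / 2 < defect by lra.
  have cond := near_pinfty_nat (cvgr_ge _ cvg_cond_defect _ condP).
  have kapP : kap / 2 < kap by lra.
  have tailK := near_pinfty_nat (cvgr_ge _ (cvg_cauchy_tailMr K0) _ kapP).
  near=> k; have k0 : 0 < k.+1%:R :> R by [].
  rewrite -[leRHS]mulNr ler_pdivlMr// mulrC defect_massE//.
  have : k.+1%:R * (cauchy_tail k.+1%:R
    - fine (P [set x | k.+1%:R < weighted_sum w (X x)])) <= dl.
    by near: k; exact: gap.
  have : defect / 2 <= cond_angle_mean P X N (sign_defect w) k.+1%:R.
    by near: k; exact: cond.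
  have : kap / 2 <= k.+1%:R * cauchy_tail (k.+1%:R * K).
    by near: k; exact: tailK.
  have := KP _ k0; set p := fine (P [set x | k.+1%:R < N (X x)]).
  set c := cond_angle_mean _ _ _ _ _; set a := _ - fine _; set t := _.+1%:R.
  move=> kp tk cD ga.
  have tp : kap / 2 <= t * p by rewrite (le_trans tk)// ler_wpM2l// ltW.
  have : defect / 2 * (kap / 2) <= c * (t * p).
    by rewrite ler_pM// ltW// divr_gt0.
  move: ga; rewrite /dl; nra.
move=> m; have := BP m; rewrite ler_norml => /andP[+ _].
exact.
Unshelve. all: by end_near. Qed.

End angular.

End core.

Unset Implicit Arguments.

(** A coordinate of weight 0 does not affect [weighted_sum], so [L = 1] is compatible with mixed
    signs there; the implication from [L = 1] is stated for positive weights. *)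
Theorem corollary2 (R : realType) (n : nat) (w : 'I_n.+1 -> R)
    (w_ge0 : forall i, 0 <= w i) (w_sum1 : \sum_i w i = 1) :
  universally_honest cauchy_cdf (weighted_sum w) /\
  forall (disp : measure_display) (T : measurableType disp)
    (P : probability T R) (U : 'I_n.+1 -> {RV P >-> R}),
    uniform_marginals U ->
    mreg_varying P (scores cauchy_cdf U) ->
    exists L : R,
      [/\ tail_ratio P (weighted_sum w) (scores cauchy_cdf U) t
            @[t --> +oo] --> L,
          L <= 1
        & forall (N : 'rV[R]_n.+1 -> R)
            (sigma : probability (borelRV R n.+1) R),
            is_norm N ->
            angular_measure P (scores cauchy_cdf U) N sigma ->
            ((forall i, 0 < w i) ->
               (L = 1 <-> sigma same_sign_orthants = 1%E)) /\
            (sigma same_sign_orthants = 1%E -> L = 1)].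
Proof.
have p0 := pi_gt0 R.
(* The second conjunct is proved first in effect: honesty follows from the existence of a limit at
   most 1. *)
apply: (fun hon (lim : _) => conj (hon lim) lim).
  move=> lim disp T P U unif rv; have [L [ratioL L1 _]] := lim _ _ _ _ unif rv.
  exact: limf_esup_le ratioL L1.
move=> disp T P U unif rv; set X := scores cauchy_cdf U.
have mX : measurable_fun setT (X : T -> borelRV R n.+1) by case: rv.
have mXi i : measurable_fun setT (fun x => X x ord0 i).
  exact: (measurable_comp_rV mX (@coord_continuous _ _ _ _ _)).
have tail_right := scores_tail_right unif mXi.
have tail_left := scores_tail_left unif mXi.
have wZ t x : 0 < t -> weighted_sum w (t *: x) = t * weighted_sum w x.
  by move=> _; exact: weighted_sumZ.
have wK x : `|weighted_sum w x| <= 1 * `|x|.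
  rewrite mul1r (le_trans (ler_norm_sum _ _ _))// -[leRHS]mul1r -w_sum1 mulr_suml.
  apply: ler_sum => i _; rewrite normrM ger0_norm// ler_wpM2l//.
  exact: norm_coord_le.
have [l wl] := regular_variation_tail_cvg mX tail_right tail_left rv
  (@continuous_weighted_sum _ _ w) wZ ltr01 wK.
(* Numerator and denominator of the ratio, each multiplied by [t], tend to [l] and [pi^-1]. *)
exists (l / pi^-1); split.
- have piV0 : (pi : R)^-1 != 0 by rewrite invr_neq0// gt_eqF.
  have : (t * fine (P [set x | t < weighted_sum w (X x)])) / (t * cauchy_tail t)
    @[t --> +oo] --> l / pi^-1.
    by apply: cvgM => //; apply: cvgV => //; exact: cvg_mul_cauchy_tail.
  apply: cvg_trans; apply: near_eq_cvg; near=> t.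
  have t0 : 0 < t by near: t; apply: nbhs_pinfty_gt; exact: num_real.
  rewrite /tail_ratio (tail_right ord0 t)/=.
  by rewrite invfM mulrACA mulfV ?gt_eqF// mul1r.
- rewrite ler_pdivrMr ?invr_gt0// mul1r.
  exact: (weighted_tail_le w_ge0 w_sum1 mX tail_right tail_left).
move=> N sigma N_norm Xs; have [sS _] := Xs.
have LE : (l / pi^-1 = 1) <-> (l = pi^-1).
  split=> [/divr1_eq//|->]; rewrite divff// invr_neq0//.
  by rewrite gt_eqF.
have eq_same : sigma same_sign_orthants = 1%E -> l / pi^-1 = 1.
  move=> s1; apply/LE.
  apply: (weighted_tail_eq w_ge0 w_sum1 mX tail_right tail_left wl N_norm Xs).
  exact: sign_defect_integral_same_sign.
split=> // w0; split=> // /LE l_eq.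
apply: (same_sign_sign_defect_integral N_norm w_ge0 w_sum1 sS w0).
apply/eqP; have := sign_defect_integral_ge0 N sigma w_ge0.
rewrite le_eqVlt eq_sym => /orP[//|I0].
have := weighted_tail_neq w_ge0 w_sum1 mX tail_right tail_left wl N_norm Xs I0.
by rewrite l_eq eqxx.
Unshelve. all: by end_near. Qed.
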